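(* For every $H\in\mathcal{P}(n)$ it holds $$\mathcal{SR}_H(\Omega_D)=\mathcal{S}_H(\Omega_D)\cap\bigcap_{h\in H}\ker(\partial/\partial x_h^c).$$
   Context: $\mathbb{H}$ is the algebra of quaternions, $\mathbb{S}_{\mathbb{H}}=\{q\in\mathbb{H}: q^2=-1\}$. $n\ge1$ is an integer; $\mathcal{P}(n)$ is the set of subsets of $\{1,\dots,n\}$. For $K=\{k_1<\dots<k_p\}\in\mathcal{P}(n)$ and quaternions $q_{k_1},\dots,q_{k_p}$, put $q_K=q_{k_1}\cdots q_{k_p}$ ($q_\emptyset=1$), and $[q_K,a]=q_K\,a$ for $a\in\mathbb{H}$. For $z\in\mathbb{C}^n$, $\overline{z}^h$ is $z$ with its $h$-th coordinate conjugated. $D\subset\mathbb{C}^n$ is a set invariant with respect to complex conjugation, i.e. $z\in D\iff\overline{z}^h\in D$ for every $h$. Its circularization is $\Omega_D=\{(\alpha_l+J_l\beta_l)_{l=1}^n: (\alpha_l+i\beta_l)_{l=1}^n\in D,\ J_1,\dots,J_n\in\mathbb{S}_{\mathbb{H}}\}\subset\mathbb{H}^n$. Let $\{e_K\}_{K\in\mathcal{P}(n)}$ be a basis of $\mathbb{R}^{2^n}$. A stem function is $F=\sum_{K}e_KF_K:D\to\mathbb{H}\otimes\mathbb{R}^{2^n}$, $F_K:D\to\mathbb{H}$, with $F_K(\overline{z}^h)=(-1)^{|K\cap\{h\}|}F_K(z)$ for all $K,h,z$. $F$ induces the slice function $f=\mathcal{I}(F):\Omega_D\to\mathbb{H}$,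 $f(x)=\sum_K[J_K,F_K(z)]$ for $x=(\alpha_l+J_l\beta_l)_l$, $z=(\alpha_l+i\beta_l)_l\in D$. $\mathcal{S}(\Omega_D)$ is the set of slice functions; each slice function is induced by a unique stem function. $\mathcal{S}^1(\Omega_D)$ is the set of slice functions induced by stem functions of class $\mathcal{C}^1$ on $D$. One variable: for $E\subset\mathbb{C}$ conjugation invariant and $\Omega_E=\{\alpha+J\beta:\alpha+i\beta\in E, J\in\mathbb{S}_{\mathbb{H}}\}$, a function $g:\Omega_E\to\mathbb{H}$ is slice if $g(\alpha+J\beta)=G_1(\alpha+i\beta)+J\,G_2(\alpha+i\beta)$ for functions $G_1,G_2:E\to\mathbb{H}$ with $G_1(\overline w)=G_1(w)$, $G_2(\overline w)=-G_2(w)$; it is slice regular if moreover $G_1,G_2$ are $\mathcal{C}^1$ with $\partial_\alpha G_1=\partial_\beta G_2$, $\partial_\beta G_1=-\partial_\alpha G_2$. For $y\in\Omega_D$ let $\Omega_{D,h}(y)=\{x\in\mathbb{H}:(y_1,\dots,y_{h-1},x,y_{h+1},\dots,y_n)\in\Omega_D\}$ (a set of the form $\Omega_E$) and $f^y_h:\Omega_{D,h}(y)\to\mathbb{H}$, $f^y_h(x)=f(y_1,\dots,y_{h-1},x,y_{h+1},\dots,y_n)$. $\mathcal{S}_h(\Omega_D)$ (resp. $\mathcal{SR}_h(\Omega_D)$) is the set of $f\in\mathcal{S}(\Omega_D)$ such that $f^y_h$ is a one-variable slice (resp. slice regular) function for every $y\in\Omega_D$; $\mathcal{S}_H(\Omega_D)=\bigcap_{h\in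 H}\mathcal{S}_h(\Omega_D)$ and $\mathcal{SR}_H(\Omega_D)=\bigcap_{h\in H}\mathcal{SR}_h(\Omega_D)$. Let $\mathcal{J}_h$ be the linear map of $\mathbb{H}\otimes\mathbb{R}^{2^n}$ with $\mathcal{J}_h(e_Ka)=e_{K\cup\{h\}}a$ if $h\notin K$ and $\mathcal{J}_h(e_Ka)=-e_{K\setminus\{h\}}a$ if $h\in K$, for $a\in\mathbb{H}$. For a stem function $F$ of class $\mathcal{C}^1$ on $D$, with $z_h=\alpha_h+i\beta_h$, put $\overline{\partial}_hF=\frac12\big(\frac{\partial F}{\partial\alpha_h}+\mathcal{J}_h\big(\frac{\partial F}{\partial\beta_h}\big)\big)$, which is again a stem function; for $f=\mathcal{I}(F)\in\mathcal{S}^1(\Omega_D)$ put $\frac{\partial f}{\partial x_h^c}=\mathcal{I}(\overline{\partial}_hF)$. Thus $\ker(\partial/\partial x_h^c)$ is the set of $f\in\mathcal{S}^1(\Omega_D)$ with $\frac{\partial f}{\partial x_h^c}=0$.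
   Formalization: D is taken open. For non-empty proper H the identity fails as stated (n=2, D=C^2, H={1}: f(x)=|Re x_2| lies only in the left side), so it is proved with both sides intersected with S^1(Omega_D); for H empty or {1,...,n} it is proved literally. *)

(* Defs.v *)
From HB Require Import structures.
From mathcomp Require Import all_boot all_order all_algebra.
From mathcomp Require Import ring complex.
From mathcomp Require Import boolp classical_sets functions reals.
From mathcomp Require Import topology normedtype derive.

Set Implicit Arguments.
Unset Strict Implicit.
Unset Printing Implicit Defensive.

Import Order.TTheory GRing.Theory Num.Theory.
Import numFieldNormedType.Exports.

Local Open Scope classical_set_scope.
Local Open Scope ring_scope.

(* The row (a, b, c, d) stands for a + b i + c j + d k.  As an alias of
   'rV[R]_4, quat R inherits the topology of R^4; row vectors have no ring
   structure in MathComp, so the Hamilton product does not clash. *)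
Definition quat (R : realType) : Type := 'rV[R]_4.

HB.instance Definition _ (R : realType) := NormedModule.on (quat R).

Section Quaternions.
Variable R : realType.
Implicit Types p q r : quat R.

Definition mkquat (a b c d : R) : quat R := \row_i [:: a; b; c; d]`_i.

Definition qcoord q (k : nat) : R := (q : 'rV[R]_4) 0 (inord k).

Definition qone : quat R := mkquat 1 0 0 0.

Definition qmul p q : quat R :=
  let a k := qcoord p k in
  let b k := qcoord q k in
  mkquat (a 0 * b 0 - a 1 * b 1 - a 2 * b 2 - a 3 * b 3)
         (a 0 * b 1 + a 1 * b 0 + a 2 * b 3 - a 3 * b 2)
         (a 0 * b 2 - a 1 * b 3 + a 2 * b 0 + a 3 * b 1)
         (a 0 * b 3 + a 1 * b 2 - a 2 * b 1 + a 3 * b 0).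

Lemma qcoord_mkquat a b c d k : (k < 4)%N ->
  qcoord (mkquat a b c d) k = [:: a; b; c; d]`_k.
Proof. by move=> k4; rewrite /qcoord mxE inordK. Qed.

Lemma quatP p q : (forall k, (k < 4)%N -> qcoord p k = qcoord q k) -> p = q.
Proof.
move=> pq; apply/rowP => i; have := pq i (ltn_ord i).
by rewrite /qcoord inord_val.
Qed.

Lemma qcoordD p q k : qcoord (p + q) k = qcoord p k + qcoord q k.
Proof. by rewrite /qcoord mxE. Qed.

Lemma qcoordZ (a : R) p k : qcoord (a *: p) k = a * qcoord p k.
Proof. by rewrite /qcoord mxE. Qed.

Let qE := (qcoordD, qcoordZ, qcoord_mkquat).

Fact qmulA : associative qmul.
Proof.
by move=> p q r; apply: quatP => -[|[|[|[|//]]]] _; rewrite /qmul !qE //=; ring.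
Qed.

Fact qmul1 : left_id qone qmul.
Proof.
by move=> p; apply: quatP => -[|[|[|[|//]]]] _; rewrite /qmul !qE //=; ring.
Qed.

Fact qmulr1 : right_id qone qmul.
Proof.
by move=> p; apply: quatP => -[|[|[|[|//]]]] _; rewrite /qmul !qE //=; ring.
Qed.

Fact qmulDl : left_distributive qmul +%R.
Proof.
by move=> p q r; apply: quatP => -[|[|[|[|//]]]] _; rewrite /qmul !qE //=; ring.
Qed.

Fact qmulDr : right_distributive qmul +%R.
Proof.
by move=> p q r; apply: quatP => -[|[|[|[|//]]]] _; rewrite /qmul !qE //=; ring.
Qed.

Fact qone_neq0 : qone != 0 :> quat R.
Proof.
apply/eqP => /(congr1 (fun q => qcoord q 0)).
by rewrite qcoord_mkquat //= /qcoord mxE => /eqP; rewrite oner_eq0.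
Qed.

Fact qscalerAl (a : R) p q : a *: qmul p q = qmul (a *: p) q.
Proof.
by apply: quatP => -[|[|[|[|//]]]] _; rewrite /qmul !qE //=; ring.
Qed.

Fact qscalerAr (a : R) p q : a *: qmul p q = qmul p (a *: q).
Proof.
by apply: quatP => -[|[|[|[|//]]]] _; rewrite /qmul !qE //=; ring.
Qed.

HB.instance Definition _ := GRing.Zmodule_isNzRing.Build (quat R)
  qmulA qmul1 qmulr1 qmulDl qmulDr qone_neq0.

HB.instance Definition _ := GRing.Lmodule_isLalgebra.Build R (quat R) qscalerAl.

HB.instance Definition _ := GRing.Lalgebra_isAlgebra.Build R (quat R) qscalerAr.

(* the sphere of imaginary units *)
Definition imag_units : set (quat R) := [set q | q ^+ 2 = -1].

(* alpha + J beta, for w = alpha + i beta *)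
Definition slice_point (J : quat R) (w : R[i]) : quat R :=
  (complex.Re w)%:A + J * (complex.Im w)%:A.

End Quaternions.

(* R[i]^o rather than R[i], since only the former carries a topology. *)
Notation cplx R := (R[i]^o)%type.

Definition subst_coord (T : Type) (n : nat) (z : 'rV[T]_n) (h : 'I_n) (w : T) :
  'rV[T]_n := \row_l (if l == h then w else z 0 l).

Section OneVariable.
Variable R : realType.
Implicit Types (g : cplx R -> quat R) (w : cplx R) (E : set (cplx R)).

Definition along_re g w (t : R) : quat R := g (w + t%:C%C).
Definition along_im g w (t : R) : quat R := g (w + (0 +i* t)%C).

Definition d_alpha g w : quat R := 'D_1 (along_re g w) 0.
Definition d_beta g w : quat R := 'D_1 (along_im g w) 0.

(* Functions on E are represented by total functions whose values off E are
   irrelevant; this notion is therefore meaningful for open E only. *)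
Definition C1_one E g : Prop := forall w, E w ->
  [/\ derivable (along_re g w) 0 1, derivable (along_im g w) 0 1,
      {for w, continuous (d_alpha g)} & {for w, continuous (d_beta g)}].

Definition conj_invariant_one E : Prop := forall w, E w <-> E (conjc w).

Definition circ_one E : set (quat R) :=
  [set x | exists w J, [/\ E w, imag_units J & x = slice_point J w]].

Definition represents_one E (G1 G2 : cplx R -> quat R) (g : quat R -> quat R) :
    Prop :=
  [/\ forall w, E w -> G1 (conjc w) = G1 w,
      forall w, E w -> G2 (conjc w) = - G2 w &
      forall w J, E w -> imag_units J -> g (slice_point J w) = G1 w + J * G2 w].

(* The conjugation invariant E with U = circ_one E is unique if it exists. *)
Definition slice_one (U : set (quat R)) (g : quat R -> quat R) : Prop :=
  exists E, [/\ conj_invariant_one E, U = circ_one E &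
    exists G1 G2, represents_one E G1 G2 g].

Definition slice_regular_one (U : set (quat R)) (g : quat R -> quat R) : Prop :=
  exists E, [/\ conj_invariant_one E, U = circ_one E &
    exists G1 G2, [/\ represents_one E G1 G2 g, C1_one E G1, C1_one E G2,
      forall w, E w -> d_alpha G1 w = d_beta G2 w &
      forall w, E w -> d_beta G1 w = - d_alpha G2 w]].

End OneVariable.

Section SeveralVariables.
Variables (R : realType) (n : nat).
Implicit Types (z : 'rV[cplx R]_n) (D : set 'rV[cplx R]_n) (h : 'I_n).
Implicit Types (K H : {set 'I_n}) (x y : 'rV[quat R]_n).
Implicit Types (f : 'rV[quat R]_n -> quat R).

Definition conj_coord h z : 'rV[cplx R]_n := subst_coord z h (conjc (z 0 h)).

Definition conj_invariant D : Prop := forall h z, D z <-> D (conj_coord h z).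

Definition slice_points (J : 'I_n -> quat R) z : 'rV[quat R]_n :=
  \row_l slice_point (J l) (z 0 l).

Definition circ D : set 'rV[quat R]_n :=
  [set x | exists z J,
    [/\ D z, forall l, imag_units (J l) & x = slice_points J z]].

(* The tensor product of the quaternions with R^(2^n), the basis of the latter
   being indexed by the subsets of 'I_n: A stands for \sum_K e_K (A K). *)
Definition qtensor : Type := {ffun {set 'I_n} -> quat R}.
HB.instance Definition _ := GRing.Lmodule.on qtensor.

Definition e_ K (a : quat R) : qtensor := [ffun L => if L == K then a else 0].

Definition calJ h (A : qtensor) : qtensor :=
  \sum_(K : {set 'I_n}) (if h \in K then - e_ (K :\ h) (A K) else e_ (h |: K) (A K)).

Implicit Type F : 'rV[cplx R]_n -> qtensor.

(* [q_K, a]; index_enum 'I_n is increasing, hence so are the indices of the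
   (noncommutative) product. *)
Definition qbracket (q : 'I_n -> quat R) K (a : quat R) : quat R :=
  (\prod_(k in K) q k) * a.

Definition stem D F : Prop := forall K h z, D z ->
  F (conj_coord h z) K = (-1) ^+ #|K :&: [set h]%SET| * F z K.

(* f = I(F) on circ D.  Functions on D and on circ D are represented by total
   functions whose values off these sets are irrelevant. *)
Definition induces D F f : Prop :=
  forall z J, D z -> (forall l, imag_units (J l)) ->
    f (slice_points J z) = \sum_(K : {set 'I_n}) qbracket J K (F z K).

Definition in_coord (T : Type) (G : 'rV[cplx R]_n -> T) h z : cplx R -> T :=
  fun w => G (subst_coord z h w).

Definition pd_alpha h (G : 'rV[cplx R]_n -> quat R) z : quat R :=
  d_alpha (in_coord G h z) (z 0 h).
Definition pd_beta h (G : 'rV[cplx R]_n -> quat R) z : quat R :=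
  d_beta (in_coord G h z) (z 0 h).

(* As above, meaningful for open D only. *)
Definition C1 D (G : 'rV[cplx R]_n -> quat R) : Prop := forall z h, D z ->
  [/\ derivable (along_re (in_coord G h z) (z 0 h)) 0 1,
      derivable (along_im (in_coord G h z) (z 0 h)) 0 1,
      {for z, continuous (pd_alpha h G)} & {for z, continuous (pd_beta h G)}].

Definition C1_stem D F : Prop := stem D F /\ forall K, C1 D (fun z => F z K).

Definition dbar h F : 'rV[cplx R]_n -> qtensor := fun z =>
  2^-1 *: (([ffun K => pd_alpha h (fun u => F u K) z] : qtensor) +
           calJ h [ffun K => pd_beta h (fun u => F u K) z]).

Definition slice D : set ('rV[quat R]_n -> quat R) :=
  [set f | exists2 F, stem D F & induces D F f].

Definition slice_C1 D : set ('rV[quat R]_n -> quat R) :=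
  [set f | exists2 F, C1_stem D F & induces D F f].

(* The stem function of f is unique on D, so it may be quantified
   existentially. *)
Definition ker_dbar D h : set ('rV[quat R]_n -> quat R) :=
  [set f | exists F,
    [/\ C1_stem D F, induces D F f & induces D (dbar h F) (fun=> 0)]].

Definition circ_section D h y : set (quat R) :=
  [set q | circ D (subst_coord y h q)].

Definition fun_section f h y : quat R -> quat R :=
  fun q => f (subst_coord y h q).

Definition slice_wrt D h : set ('rV[quat R]_n -> quat R) :=
  [set f | slice D f /\
    forall y, circ D y -> slice_one (circ_section D h y) (fun_section f h y)].

Definition slice_regular_wrt D h : set ('rV[quat R]_n -> quat R) :=
  [set f | slice D f /\ forall y, circ D y ->
    slice_regular_one (circ_section D h y) (fun_section f h y)].

(* The intersections over h in H are taken inside slice D, which matters only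
   for empty H. *)
Definition slice_in D H : set ('rV[quat R]_n -> quat R) :=
  slice D `&` \bigcap_(h in [set` H]) slice_wrt D h.

(* Membership in slice_regular_wrt D h demands no regularity in the variables
   other than x_h: with n = 2 and D the whole space, x |-> |Re x_2| is slice
   regular with respect to x_1 but is not in slice_C1 D, whereas ker_dbar D h is
   contained in slice_C1 D. *)
Definition slice_regular_in D H : set ('rV[quat R]_n -> quat R) :=
  slice D `&` \bigcap_(h in [set` H]) slice_regular_wrt D h.

End SeveralVariables.

(* Main.v *)
Require Import Defs.
From HB Require Import structures.
From mathcomp Require Import all_boot all_order all_algebra.
From mathcomp Require Import ring lra complex.
From mathcomp Require Import boolp classical_sets functions reals.
From mathcomp Require Import topology normedtype derive.

Set Implicit Arguments.
Unset Strict Implicit.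
Unset Printing Implicit Defensive.

Import Order.TTheory GRing.Theory Num.Theory.
Import numFieldNormedType.Exports.

Local Open Scope classical_set_scope.
Local Open Scope ring_scope.

(** Write a stem function as F = sum_K e_K F_K and fix h.  On the plane through
    z in the direction h, the subsets of the index set come in pairs
    (L, h |: L) with h \notin L, and the equation dbar_h F = 0 says exactly that
    each pair (F_L, F_(h |: L)) satisfies the Cauchy-Riemann equations in z_h
    ([dbar_eq0]).  So the theorem says that the one-variable stems of the
    sections of f, whose two components mix the F_K with products of imaginary
    units, are all holomorphic exactly when all these pairs are.

    Two facts make the translation possible.  First, replacing J_l by - J_l in
    all combinations turns f into its signed variants, and averaging these
    against the sign characters recovers each product J_K F_K from values of f
    ([bracket_extraction]).  Second, if f is slice in x_h, then J_h can be pulled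
    to the left in J_(h |: L) F_(h |: L): an identity A J q = J c valid for all
    imaginary units J forces A to commute with every J unless q = 0
    ([central_of_units], [bracket_commute]).  Hence the one-variable stem is
    G1 = sum_L J_L F_L, G2 = sum_L J_L F_(h |: L), over the L with h \notin L.
    Conversely F_L and F_(h |: L) are combinations, with one and the same system
    of constant coefficients, of the G1 and of the G2 of finitely many sections.
    The Cauchy-Riemann equations pass through such combinations in both directions
    ([slice_regular_cauchy_riemann], [cauchy_riemann_slice_regular]), which gives
    the equality within slice functions of class C^1.

    When H is the full index set, regularity in each variable separately forces
    the stem function to be of class C^1.  Indeed, pulling out both J_h
    and J_k from J_K F_K is impossible for h != k unless F_K = 0
    ([slice_wrt_vanish]), so only F_set0 and the F_[set h] survive.  The
    Cauchy-Riemann equations of the pair ([set h], k |: [set h]) then make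
    F_[set h] locally constant in z_k, so that locally it depends on z_h alone
    and its partial derivatives are continuous because they are so in one
    variable ([cst_on_polydisc], [pd_continuous_local]); those of F_set0 are, up
    to sign, derivatives of the F_[set h] ([slice_regular_all_C1]). *)

(** * Quaternions and imaginary units *)

Section QuaternionAlgebra.
Variable R : realType.
Implicit Types (p q A J N : quat R) (w : cplx R).

Let qE := (@qcoordD R, @qcoordZ R, @qcoord_mkquat R).

Lemma qcoordN q k : qcoord (- q) k = - qcoord q k.
Proof. by rewrite /qcoord mxE. Qed.

Lemma qcoord0 k : qcoord (0 : quat R) k = 0.
Proof. by rewrite /qcoord mxE. Qed.

Lemma qmulE p q : p * q = qmul p q. Proof. by []. Qed.

Lemma qcoordA (a : R) : a%:A = mkquat a 0 0 0 :> quat R.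
Proof.
apply: quatP => k k4; rewrite qcoordZ !qcoord_mkquat //.
by case: k k4 => [|[|[|[|]]]] //= _; rewrite ?mulr1 ?mulr0.
Qed.

Definition quat_i : quat R := mkquat 0 1 0 0.
Definition quat_j : quat R := mkquat 0 0 1 0.

Lemma quat_i_unit : imag_units quat_i.
Proof.
rewrite /imag_units /= expr2 qmulE; apply: quatP => -[|[|[|[|//]]]] _;
  rewrite qcoordN /qmul !qE //=; ring.
Qed.

Lemma quat_j_unit : imag_units quat_j.
Proof.
rewrite /imag_units /= expr2 qmulE; apply: quatP => -[|[|[|[|//]]]] _;
  rewrite qcoordN /qmul !qE //=; ring.
Qed.

Lemma quat_ij : quat_i * quat_j = - (quat_j * quat_i).
Proof.
rewrite !qmulE; apply: quatP => -[|[|[|[|//]]]] _;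
  rewrite qcoordN /qmul !qE //=; ring.
Qed.

Lemma imag_units_sqr J : imag_units J -> J * J = -1.
Proof. by rewrite /imag_units /= expr2. Qed.

Lemma imag_unitsN J : imag_units J -> imag_units (- J).
Proof. by rewrite /imag_units /= sqrrN. Qed.

Lemma quat_ij_unit : imag_units (quat_i * quat_j).
Proof.
rewrite /imag_units /= expr2 {1}quat_ij mulNr -!mulrA [quat_i * (_ * _)]mulrA.
by rewrite (imag_units_sqr quat_i_unit) mulN1r mulrN opprK (imag_units_sqr quat_j_unit).
Qed.

Lemma imag_units_mulNl J q : imag_units J -> - J * (J * q) = q.
Proof. by move=> /imag_units_sqr JJ; rewrite mulrA mulNr JJ opprK mul1r. Qed.

Lemma imag_units_lreg J p q : imag_units J -> J * p = J * q -> p = q.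
Proof. by move=> uJ e; rewrite -[p](imag_units_mulNl _ uJ) e imag_units_mulNl. Qed.

Lemma quat_rinv q : q != 0 -> exists q', q * q' = 1.
Proof.
move=> q0; pose a k := qcoord q k; pose s := a 0 ^+ 2 + a 1 ^+ 2 + a 2 ^+ 2 + a 3 ^+ 2.
have s0 : s != 0.
  apply: contra q0; rewrite /s !paddr_eq0 ?addr_ge0 ?sqr_ge0 // !sqrf_eq0.
  move=> /andP[/andP[/andP[/eqP a0 /eqP a1] /eqP a2] /eqP a3]; apply/eqP.
  by apply: quatP => -[|[|[|[|//]]]] _; rewrite qcoord0.
exists (mkquat (a 0 / s) (- a 1 / s) (- a 2 / s) (- a 3 / s)).
rewrite qmulE; apply: quatP => -[|[|[|[|//]]]] _;
  rewrite /qmul !qE //= -/(a 0) -/(a 1) -/(a 2) -/(a 3); rewrite /s; field; exact: s0.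
Qed.

Lemma quat_rreg q p p' : q != 0 -> p * q = p' * q -> p = p'.
Proof.
move=> /quat_rinv[q' qq'] e.
by rewrite -[p]mulr1 -[p']mulr1 -qq' !mulrA e.
Qed.

(** Comparing A (i j) = (i j) N with A i = i N shows that N commutes with j, and
    then A j = j N = N j. *)
Lemma conj_by_units A N : (forall J, imag_units J -> A * J = J * N) -> A = N.
Proof.
move=> AN; have Nj : N * quat_j = quat_j * N.
  apply: (imag_units_lreg quat_i_unit).
  by rewrite mulrA -(AN _ quat_i_unit) -mulrA AN ?mulrA //; exact: quat_ij_unit.
apply: (@imag_units_lreg (- quat_j)); first exact/imag_unitsN/quat_j_unit.
have : (A - N) * quat_j = 0 by rewrite mulrBl Nj (AN _ quat_j_unit) subrr.
move=> /(congr1 (fun q => q * quat_j)).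
rewrite -mulrA (imag_units_sqr quat_j_unit) mulrN1 mul0r => /eqP.
by rewrite oppr_eq0 subr_eq0 => /eqP ->.
Qed.

(** For q != 0, cancelling q gives A J = J N for all J with N = c q^-1, whence
    A = N. *)
Lemma central_of_units A q c : (forall J, imag_units J -> A * J * q = J * c) ->
  forall J, imag_units J -> A * J * q = J * A * q.
Proof.
move=> Ac J uJ; have [->|/[dup] q0 /quat_rinv[q' qq']] := eqVneq q 0.
  by rewrite !mulr0.
have AN J' : imag_units J' -> A * J' = J' * (c * q').
  by move=> /Ac; rewrite mulrA => <-; rewrite -(mulrA _ q) qq' mulr1.
by rewrite AN // -(conj_by_units AN).
Qed.

Lemma central_scalar A : (forall J, imag_units J -> A * J = J * A) ->
  A = (qcoord A 0)%:A.
Proof.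
move=> Ac; have c J k : imag_units J -> qcoord (qmul A J) k = qcoord (qmul J A) k.
  by move=> /Ac; rewrite !qmulE => ->.
move: (c _ 1%N quat_j_unit) (c _ 3%N quat_j_unit) (c _ 3%N quat_i_unit).
rewrite /qmul !qE //= => c1 c2 c3.
by rewrite qcoordA; apply: quatP => -[|[|[|[|//]]]] _; rewrite !qE //=; lra.
Qed.

(** If X i Y and X j Y commute with all units they are real, so i and j lie on
    the same real line and commute, which they do not. *)
Lemma no_central_conj X Y X' Y' : X' * X = 1 -> Y * Y' = 1 ->
  (forall J J', imag_units J -> imag_units J' -> X * J * Y * J' = J' * (X * J * Y)) ->
  False.
Proof.
move=> XX YY cJ.
have line J : imag_units J -> exists a : R, J = a *: (X' * Y').
  move=> uJ; have /central_scalar e := fun J' => cJ J J' uJ.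
  exists (qcoord (X * J * Y) 0).
  set a := qcoord _ _ in e *.
  have -> : J = X' * (X * J * Y) * Y'.
    by rewrite -(mulrA X) !mulrA XX mul1r -mulrA YY mulr1.
  by rewrite e mulr_algr -scalerAl.
have [a ia] := line _ quat_i_unit; have [b jb] := line _ quat_j_unit.
have ij_ji : quat_i * quat_j = quat_j * quat_i.
  by rewrite ia jb -!scalerAl -!scalerAr !scalerA mulrC.
have ij0 : quat_i * quat_j = 0.
  have : 2%:R *: (quat_i * quat_j) = 0.
    by rewrite scaler_nat mulr2n {1}quat_ij ij_ji addNr.
  by move=> /eqP; rewrite scaler_eq0 pnatr_eq0 /= => /eqP.
move: quat_ij_unit; rewrite /imag_units /= ij0 expr0n /= => /eqP.
by rewrite eq_sym oppr_eq0 oner_eq0.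
Qed.

(** J^2 = -1 forces J to be purely imaginary of norm 1. *)
Lemma slice_point_coord J w : imag_units J ->
  (complex.Re w = qcoord (slice_point J w) 0) /\
  complex.Im w ^+ 2 = qcoord (slice_point J w) 1 ^+ 2 +
     qcoord (slice_point J w) 2 ^+ 2 + qcoord (slice_point J w) 3 ^+ 2.
Proof.
move=> /imag_units_sqr; rewrite qmulE => JJ.
have c k : qcoord (qmul J J) k = qcoord (-1) k by rewrite JJ.
have J0 : qcoord J 0 = 0.
  move: (c 0%N) (c 1%N) (c 2%N) (c 3%N).
  rewrite !qcoordN /qmul !qE //= => c0 c1 c2 c3.
  apply/eqP/negPn/negP => J0.
  have z k : qcoord J 0 * qcoord J k + qcoord J k * qcoord J 0 = 0 -> qcoord J k = 0.
    move=> e; have : qcoord J 0 * qcoord J k = 0 by lra.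
    by move=> /eqP; rewrite mulf_eq0 (negPf J0) /= => /eqP.
  have [J1 J2 J3] : [/\ qcoord J 1 = 0, qcoord J 2 = 0 & qcoord J 3 = 0].
    by split; apply: z; lra.
  by move: c0; rewrite J1 J2 J3; nra.
have JS : qcoord J 1 ^+ 2 + qcoord J 2 ^+ 2 + qcoord J 3 ^+ 2 = 1.
  by move: (c 0%N); rewrite qcoordN /qmul !qE //= J0; nra.
rewrite /slice_point !qcoordA !qmulE /qmul !qE //= J0.
by split; [ring|rewrite -[LHS]mulr1 -JS; ring].
Qed.

(** The point alpha + J beta determines alpha and beta^2. *)
Lemma slice_point_inj J J' w w' : imag_units J -> imag_units J' ->
  slice_point J w = slice_point J' w' -> w' = w \/ w' = conjc w.
Proof.
move=> uJ uJ' e; have [r i] := slice_point_coord w uJ.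
have [r' i'] := slice_point_coord w' uJ'.
move: r i; rewrite e -r' -i' {r' i' e}; case: w w' => a b [c d] /= ->.
by move=> /eqP; rewrite eqf_sqr => /orP[]/eqP ->; [left|right; rewrite opprK].
Qed.

End QuaternionAlgebra.

(** * One-variable calculus and the Cauchy-Riemann equations *)

Section OneVariableCalculus.
Variable R : realType.
Implicit Types (c p q : quat R) (w : cplx R) (E : set (cplx R)).
Implicit Types (g G : cplx R -> quat R).

Lemma qmul_continuous c : continuous (fun q => c * q).
Proof.
have e q : c * q = \sum_(k < 4) qcoord q k *: (c * (delta_mx 0 k : 'rV[R]_4)).
  rewrite {1}(row_sum_delta (q : 'rV[R]_4)) mulr_sumr; apply: eq_bigr => k _.
  by rewrite -scalerAr /qcoord inord_val.
have -> : (fun q => c * q) =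
    fun q => \sum_(k < 4) qcoord q k *: (c * (delta_mx 0 k : 'rV[R]_4)).
  by apply/funext.
apply: continuous_big => [|k _ q]; first exact: (@add_continuous (quat R)).
have qk : qcoord p k @[p --> q] --> qcoord q k by exact: (@coord_continuous R 1 4).
exact: (@cvgZr_tmp R (quat R) _ (nbhs q) (nbhs_filter q) _ _ _ qk).
Qed.

(** The condition on L is the part of linearity that moves L inside a
    difference quotient. *)
Lemma is_derive_linear (W : normedModType R) (L : quat R -> W) (f : R -> quat R)
    (x : R) (df : quat R) :
  continuous L -> (forall (a : R) p q, L (a *: (p - q)) = a *: (L p - L q)) ->
  is_derive x 1 f df -> is_derive x 1 (fun t => L (f t)) (L df).
Proof.
move=> cL lL [fx dfE].
have lim_Lf : h^-1 *: (((fun t => L (f t)) \o shift x) (h *: (1 : R)) - L (f x))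
    @[h --> 0^'] --> L df.
  have -> : (fun h : R => h^-1 *:
      (((fun t => L (f t)) \o shift x) (h *: (1 : R)) - L (f x)))
      = L \o (fun h : R => h^-1 *: ((f \o shift x) (h *: (1 : R)) - f x)).
    by apply/funext => h /=; rewrite -lL.
  by apply: cvg_comp; [exact: fx|rewrite -/('D_1 f x) dfE; exact: cL].
split; first by apply/cvg_ex; exists (L df).
by apply: cvg_lim.
Qed.

Lemma is_derive_qmul c (f : R -> quat R) (x : R) (df : quat R) :
  is_derive x 1 f df -> is_derive x 1 (fun t => c * f t) (c * df).
Proof.
apply: (is_derive_linear (qmul_continuous (c := c))) => a p q.
by rewrite -mulrBr -scalerAr.
Qed.

Lemma is_derive_qcoord k (f : R -> quat R) (x : R) (df : quat R) :
  is_derive x 1 f df -> is_derive x 1 (fun t => qcoord (f t) k) (qcoord df k).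
Proof.
have ck : continuous (fun q : quat R => qcoord q k) by exact: (@coord_continuous R 1 4).
by apply: (is_derive_linear ck) => a p q; rewrite qcoordZ qcoordD qcoordN.
Qed.

Lemma is_derive_ex (f : R -> quat R) (x : R) (df : quat R) :
  is_derive x 1 f df -> derivable f x 1.
Proof. by case. Qed.

Lemma is_derive_val (f : R -> quat R) (x : R) (df : quat R) :
  is_derive x 1 f df -> 'D_1 f x = df.
Proof. by case. Qed.

Lemma near_eq_continuous (T : topologicalType) (a b : T -> quat R) (x : T) :
  (\forall u \near x, a u = b u) -> {for x, continuous a} -> {for x, continuous b}.
Proof.
move=> ab ca; rewrite /prop_for /continuous_at -(nbhs_singleton ab).
exact: cvg_trans (near_eq_cvg ab) ca.
Qed.

(** The candidate derivatives ga and gb agree with d_alpha g and d_beta g near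
    each point of E because E is open; continuity can thus be checked on them. *)
Lemma C1_one_intro E g ga gb : open E ->
  (forall w, E w -> is_derive (0 : R) 1 (along_re g w) (ga w)) ->
  (forall w, E w -> is_derive (0 : R) 1 (along_im g w) (gb w)) ->
  (forall w, E w -> {for w, continuous ga}) ->
  (forall w, E w -> {for w, continuous gb}) -> C1_one E g.
Proof.
move=> oE dga dgb cga cgb w Ew.
have nE := open_nbhs_nbhs (conj oE Ew).
split; [exact: (is_derive_ex (dga w Ew))|exact: (is_derive_ex (dgb w Ew))| |].
- apply: near_eq_continuous (cga w Ew).
  by apply: filterS nE => u Eu; rewrite /d_alpha (is_derive_val (dga u Eu)).
- apply: near_eq_continuous (cgb w Ew).
  by apply: filterS nE => u Eu; rewrite /d_beta (is_derive_val (dgb u Eu)).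
Qed.

Lemma C1_one_is_derive_re E g w : C1_one E g -> E w ->
  is_derive (0 : R) 1 (along_re g w) (d_alpha g w).
Proof. by move=> Cg /Cg[dg _ _ _]; apply: DeriveDef. Qed.

Lemma C1_one_is_derive_im E g w : C1_one E g -> E w ->
  is_derive (0 : R) 1 (along_im g w) (d_beta g w).
Proof. by move=> Cg /Cg[_ dg _ _]; apply: DeriveDef. Qed.

(** For a one-variable stem (G1, G2) this is holomorphy. *)
Definition cauchy_riemann E G1 G2 : Prop :=
  [/\ C1_one E G1, C1_one E G2,
      forall w, E w -> d_alpha G1 w = d_beta G2 w &
      forall w, E w -> d_beta G1 w = - d_alpha G2 w].

Lemma C1_one_qmul E c g : open E -> C1_one E g ->
  [/\ C1_one E (fun w => c * g w),
     forall w, E w -> d_alpha (fun w => c * g w) w = c * d_alpha g w &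
     forall w, E w -> d_beta (fun w => c * g w) w = c * d_beta g w].
Proof.
move=> oE Cg.
have da w : E w -> is_derive (0 : R) 1 (along_re (fun w => c * g w) w) (c * d_alpha g w).
  by move=> Ew; apply: is_derive_qmul; exact: C1_one_is_derive_re Cg Ew.
have db w : E w -> is_derive (0 : R) 1 (along_im (fun w => c * g w) w) (c * d_beta g w).
  by move=> Ew; apply: is_derive_qmul; exact: C1_one_is_derive_im Cg Ew.
split; last 2 first.
- by move=> w Ew; rewrite /d_alpha (is_derive_val (da w Ew)).
- by move=> w Ew; rewrite /d_beta (is_derive_val (db w Ew)).
apply: (C1_one_intro oE da db) => w /Cg[_ _ ca cb].
- by apply: (continuous_comp ca); exact: qmul_continuous.
- by apply: (continuous_comp cb); exact: qmul_continuous.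
Qed.

Lemma C1_one_add E g g' : open E -> C1_one E g -> C1_one E g' ->
  [/\ C1_one E (fun w => g w + g' w),
     forall w, E w -> d_alpha (fun w => g w + g' w) w = d_alpha g w + d_alpha g' w &
     forall w, E w -> d_beta (fun w => g w + g' w) w = d_beta g w + d_beta g' w].
Proof.
move=> oE Cg Cg'.
have da w : E w -> is_derive (0 : R) 1 (along_re (fun w => g w + g' w) w)
    (d_alpha g w + d_alpha g' w).
  by move=> Ew; apply: is_deriveD;
    [exact: C1_one_is_derive_re Cg Ew|exact: C1_one_is_derive_re Cg' Ew].
have db w : E w -> is_derive (0 : R) 1 (along_im (fun w => g w + g' w) w)
    (d_beta g w + d_beta g' w).
  by move=> Ew; apply: is_deriveD;
    [exact: C1_one_is_derive_im Cg Ew|exact: C1_one_is_derive_im Cg' Ew].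
split; last 2 first.
- by move=> w Ew; rewrite /d_alpha (is_derive_val (da w Ew)).
- by move=> w Ew; rewrite /d_beta (is_derive_val (db w Ew)).
apply: (C1_one_intro oE da db) => w Ew; have [_ _ ca cb] := Cg w Ew;
  have [_ _ ca' cb'] := Cg' w Ew.
- exact: (@continuousD _ _ _ _ _ _ ca ca').
- exact: (@continuousD _ _ _ _ _ _ cb cb').
Qed.

Lemma C1_one0 E : open E ->
  [/\ C1_one E (fun=> 0 : quat R), forall w, d_alpha (fun=> 0 : quat R) w = 0 &
      forall w, d_beta (fun=> 0 : quat R) w = 0].
Proof.
move=> oE; split=> [|w|w].
- apply: (C1_one_intro (ga := fun=> 0) (gb := fun=> 0) oE) => w _.
  + exact: is_derive_cst.
  + exact: is_derive_cst.
  + exact: cst_continuous.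
  + exact: cst_continuous.
- exact: derive_cst.
- exact: derive_cst.
Qed.

Lemma along_re_near E w : open E -> E w ->
  \forall t \near (0 : R), E (w + (t%:C)%C).
Proof.
move=> oE Ew; have := open_nbhs_nbhs (conj oE Ew).
move=> /nbhs_ballP[e /= e0 eE].
have e0' : 0 < complex.Re e by move: e0; rewrite ltcE => /andP[].
apply/nbhs_ballP; exists (complex.Re e) => //= t te; apply: eE.
rewrite /ball /= opprD addrA subrr sub0r normrN normc_def /=.
move: te; rewrite /ball /= sub0r normrN => te.
rewrite ltcE /= expr0n addr0 sqrtr_sqr te andbT.
by move: e0; rewrite ltcE => /andP[].
Qed.

Lemma along_im_near E w : open E -> E w ->
  \forall t \near (0 : R), E (w + (0 +i* t)%C).
Proof.
move=> oE Ew; have := open_nbhs_nbhs (conj oE Ew).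
move=> /nbhs_ballP[e /= e0 eE].
have e0' : 0 < complex.Re e by move: e0; rewrite ltcE => /andP[].
apply/nbhs_ballP; exists (complex.Re e) => //= t te; apply: eE.
rewrite /ball /= opprD addrA subrr sub0r normrN normc_def /=.
move: te; rewrite /ball /= sub0r normrN => te.
rewrite ltcE /= expr0n add0r sqrtr_sqr te andbT.
by move: e0; rewrite ltcE => /andP[].
Qed.

Lemma C1_one_congr E g g' : open E -> (forall w, E w -> g w = g' w) -> C1_one E g ->
  [/\ C1_one E g', forall w, E w -> d_alpha g' w = d_alpha g w &
      forall w, E w -> d_beta g' w = d_beta g w].
Proof.
move=> oE gg' Cg.
have da w : E w -> is_derive (0 : R) 1 (along_re g' w) (d_alpha g w).
  move=> Ew; apply: near_eq_is_derive (C1_one_is_derive_re Cg Ew).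
  by apply: filterS (along_re_near oE Ew) => t; exact: gg'.
have db w : E w -> is_derive (0 : R) 1 (along_im g' w) (d_beta g w).
  move=> Ew; apply: near_eq_is_derive (C1_one_is_derive_im Cg Ew).
  by apply: filterS (along_im_near oE Ew) => t; exact: gg'.
split; last 2 first.
- by move=> w Ew; rewrite {1}/d_alpha (is_derive_val (da w Ew)).
- by move=> w Ew; rewrite {1}/d_beta (is_derive_val (db w Ew)).
apply: (C1_one_intro oE da db) => w /Cg[_ _ ca cb].
- exact: ca.
- exact: cb.
Qed.

Lemma cauchy_riemann_congr E G1 G2 G1' G2' : open E ->
  (forall w, E w -> G1 w = G1' w) -> (forall w, E w -> G2 w = G2' w) ->
  cauchy_riemann E G1 G2 -> cauchy_riemann E G1' G2'.
Proof.
move=> oE e1 e2 [C1 C2 ab ba].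
have [C1' a1 b1] := C1_one_congr oE e1 C1; have [C2' a2 b2] := C1_one_congr oE e2 C2.
split=> [||w Ew|w Ew]; [exact: C1'|exact: C2'| |].
- by rewrite (a1 w Ew) (b2 w Ew) (ab w Ew).
- by rewrite (b1 w Ew) (a2 w Ew) (ba w Ew).
Qed.

Lemma cauchy_riemann_qmul E c G1 G2 : open E -> cauchy_riemann E G1 G2 ->
  cauchy_riemann E (fun w => c * G1 w) (fun w => c * G2 w).
Proof.
move=> oE [C1 C2 ab ba].
have [C1' a1 b1] := C1_one_qmul c oE C1; have [C2' a2 b2] := C1_one_qmul c oE C2.
split=> [||w Ew|w Ew]; [exact: C1'|exact: C2'| |].
- by rewrite (a1 w Ew) (b2 w Ew) (ab w Ew).
- by rewrite (b1 w Ew) (a2 w Ew) (ba w Ew) mulrN.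
Qed.

(** Together with [cauchy_riemann_qmul]: left-linear combinations with constant
    quaternionic coefficients preserve the Cauchy-Riemann equations, as these
    only involve real-linear operations on the values. *)
Lemma cauchy_riemann_sum E (I : Type) (s : seq I) (P : pred I)
    (G1 G2 : I -> cplx R -> quat R) : open E ->
  (forall i, P i -> cauchy_riemann E (G1 i) (G2 i)) ->
  cauchy_riemann E (fun w => \sum_(i <- s | P i) G1 i w)
                   (fun w => \sum_(i <- s | P i) G2 i w).
Proof.
move=> oE crG; elim: s => [|i s IHs].
  have [C0 a0 b0] := C1_one0 oE.
  apply: (cauchy_riemann_congr (G1 := fun=> 0) (G2 := fun=> 0) oE) => [w _|w _|].
  - by rewrite big_nil.
  - by rewrite big_nil.
  split=> [||w Ew|w Ew]; [exact: C0|exact: C0| |].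
  - by rewrite a0 b0.
  - by rewrite a0 b0 oppr0.
have [Pi|Pi] := boolP (P i); last first.
  apply: (cauchy_riemann_congr oE _ _ IHs) => w _.
  - by rewrite big_cons (negPf Pi).
  - by rewrite big_cons (negPf Pi).
apply: (cauchy_riemann_congr (G1 := fun w => G1 i w + \sum_(j <- s | P j) G1 j w)
   (G2 := fun w => G2 i w + \sum_(j <- s | P j) G2 j w) oE) => [w _|w _|].
- by rewrite big_cons Pi.
- by rewrite big_cons Pi.
have [C1 C2 ab ba] := crG i Pi; have [D1 D2 cd dc] := IHs.
have [C1' a1 b1] := C1_one_add oE C1 D1; have [C2' a2 b2] := C1_one_add oE C2 D2.
split=> [||w Ew|w Ew]; [exact: C1'|exact: C2'| |].
- by rewrite (a1 w Ew) (b2 w Ew) (ab w Ew) (cd w Ew).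
- by rewrite (b1 w Ew) (a2 w Ew) (ba w Ew) (dc w Ew) opprD.
Qed.

End OneVariableCalculus.

(** * Circular sets and their sections *)

Section CircularSections.
Variables (R : realType) (n : nat).
Implicit Types (z : 'rV[cplx R]_n) (D : set 'rV[cplx R]_n) (h : 'I_n).
Implicit Types (y : 'rV[quat R]_n) (J : 'I_n -> quat R) (w : cplx R).

Definition plane_section D h z : set (cplx R) := [set w | D (subst_coord z h w)].

Lemma subst_coord_same (T : Type) (z : 'rV[T]_n) h (w : T) : subst_coord z h w 0 h = w.
Proof. by rewrite mxE eqxx. Qed.

Lemma subst_coordK (T : Type) (z : 'rV[T]_n) h (w w' : T) :
  subst_coord (subst_coord z h w) h w' = subst_coord z h w'.
Proof. by apply/rowP => l; rewrite !mxE; case: eqP. Qed.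

Lemma subst_coord_id (T : Type) (z : 'rV[T]_n) h : subst_coord z h (z 0 h) = z.
Proof. by apply/rowP => l; rewrite !mxE; case: eqP => // ->. Qed.

Lemma subst_coord_continuous z h : continuous (subst_coord z h).
Proof.
move=> w U /= /nbhs_ballP[e /= e0 eU]; apply/nbhs_ballP; exists e => //= w' ww'.
apply: eU; split=> // i j; rewrite !mxE; case: eqP => // _.
exact: ballxx.
Qed.

Lemma plane_section_open D h z : open D -> open (plane_section D h z).
Proof. by move=> oD; apply: open_comp => // w _; exact: subst_coord_continuous. Qed.

Lemma conj_coord_subst z h w :
  conj_coord h (subst_coord z h w) = subst_coord z h (conjc w).
Proof. by rewrite /conj_coord subst_coord_same subst_coordK. Qed.

Lemma plane_section_conj D h z : conj_invariant D ->
  conj_invariant_one (plane_section D h z).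
Proof. by move=> cD w; rewrite /plane_section /= -conj_coord_subst; exact: cD. Qed.

(** The coordinates are conjugated one at a time. *)
Lemma conj_invariant_upto D z z' : conj_invariant D ->
  (forall l, z' 0 l = z 0 l \/ z' 0 l = conjc (z 0 l)) -> D z -> D z'.
Proof.
move=> cD zz' Dz; pose mix (s : seq 'I_n) := \row_l (if l \in s then z' 0 l else z 0 l).
suff Dm s : D (mix s).
  have <- : mix (enum 'I_n) = z' by apply/rowP => l; rewrite mxE mem_enum.
  exact: Dm.
elim: s => [|k s IHs].
  suff -> : mix [::] = z by [].
  by apply/rowP => l; rewrite mxE.
have [ks|ks] := boolP (k \in s).
  suff -> : mix (k :: s) = mix s by [].
  by apply/rowP => l; rewrite !mxE inE; case: eqP => // ->; rewrite ks.
have -> : mix (k :: s) = subst_coord (mix s) k (z' 0 k).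
  by apply/rowP => l; rewrite !mxE inE; case: eqP => // ->.
have mk : mix s 0 k = z 0 k by rewrite mxE (negPf ks).
case: (zz' k) => ->; rewrite -mk; first by rewrite subst_coord_id.
by rewrite -/(conj_coord k (mix s)) -cD.
Qed.

Lemma slice_points_inj D J J' z z' : conj_invariant D ->
  (forall l, imag_units (J l)) -> (forall l, imag_units (J' l)) ->
  slice_points J z = slice_points J' z' -> D z' -> D z.
Proof.
move=> cD uJ uJ' e; apply: conj_invariant_upto => // l.
have /rowP/(_ l) := e; rewrite !mxE => el.
exact: (slice_point_inj (uJ' l) (uJ l) (esym el)).
Qed.

Definition subst_unit J h (I : quat R) : 'I_n -> quat R :=
  fun l => if l == h then I else J l.

Lemma subst_unit_imag J h (I : quat R) : (forall l, imag_units (J l)) ->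
  imag_units I -> forall l, imag_units (subst_unit J h I l).
Proof. by move=> uJ uI l; rewrite /subst_unit; case: eqP. Qed.

Lemma subst_slice_points J z h (I : quat R) w :
  subst_coord (slice_points J z) h (slice_point I w) =
  slice_points (subst_unit J h I) (subst_coord z h w).
Proof. by apply/rowP => l; rewrite !mxE /subst_unit; case: eqP. Qed.

(** A point of the circularization determines its parameter up to conjugation
    of coordinates, under which D is invariant. *)
Lemma circ_section_plane D h J z : conj_invariant D ->
  (forall l, imag_units (J l)) ->
  circ_section D h (slice_points J z) = circ_one (plane_section D h z).
Proof.
move=> cD uJ; apply/seteqP; split=> q /=.
- move=> [z' [J' [Dz' uJ' e]]].
  have qE : q = slice_point (J' h) (z' 0 h).
    by have /rowP/(_ h) := e; rewrite subst_coord_same mxE.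
  exists (z' 0 h), (J' h); split=> //.
  move: e; rewrite qE subst_slice_points => /slice_points_inj; apply => //.
  exact: subst_unit_imag.
- move=> [w [I [Dw uI ->]]]; exists (subst_coord z h w), (subst_unit J h I).
  by rewrite subst_slice_points; split=> //; exact: subst_unit_imag.
Qed.

(** Hence the parameter set in the one-variable notions of slice function can
    be taken to be the plane section. *)
Lemma circ_one_inj (E E' : set (cplx R)) : conj_invariant_one E ->
  conj_invariant_one E' -> circ_one E = circ_one E' -> E = E'.
Proof.
wlog suff: E E' / conj_invariant_one E' -> circ_one E = circ_one E' -> E `<=` E'.
  move=> sub cE cE' e; apply/seteqP; split; [exact: sub|exact: (sub _ _ cE)].
move=> cE' e w Ew; have : circ_one E (slice_point (quat_i R) w).
  by exists w, (quat_i R); split=> //; exact: quat_i_unit.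
rewrite e => -[w' [J [Ew' uJ /slice_point_inj]]].
case/(_ (quat_i_unit R) uJ) => ww'; first by rewrite -ww'.
by apply/cE'; rewrite -ww'.
Qed.

End CircularSections.

(** * Recovering stem components by sign averages *)

Section SignCharacters.
Variables (R : realType) (n : nat).
Implicit Types (h k : 'I_n) (J : 'I_n -> quat R) (S K L : {set 'I_n}) (I : quat R).

Definition flip S J : 'I_n -> quat R := fun l => (-1) ^+ (l \in S) *: J l.

(** The characters of the group of subsets of the index set under symmetric
   difference. *)
Definition chi S K : R := \prod_(l in K) (-1) ^+ (l \in S).

Lemma flip_imag S J : (forall l, imag_units (J l)) -> forall l, imag_units (flip S J l).
Proof.
move=> uJ l; rewrite /flip; case: (l \in S); rewrite ?expr1 ?expr0 ?scale1r // scaleN1r.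
exact: imag_unitsN.
Qed.

Lemma qbracket_flip S J K (a : quat R) :
  qbracket (flip S J) K a = chi S K *: qbracket J K a.
Proof. by rewrite /qbracket /flip scaler_prod -scalerAl. Qed.

Lemma chi_toggle k S K :
  chi [set l | (l \in S) (+) (l == k)] K = (-1) ^+ (k \in K) * chi S K.
Proof.
rewrite /chi; under eq_bigr => l _ do rewrite inE signr_addb.
rewrite big_split /= mulrC; congr (_ * _).
have [kK|kK] := boolP (k \in K).
  rewrite (bigD1 k) //= eqxx big1 ?mulr1 // => l /andP[_ /negPf ->] //.
by rewrite big1 // => l lK; case: eqP => // lk; rewrite -lk lK in kK.
Qed.

Lemma chi_sqr S K : chi S K * chi S K = 1.
Proof.
by rewrite /chi -big_split /= big1 // => l _; rewrite -signr_addb addbb.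
Qed.

Lemma chi_setU1 S h L : h \notin S -> h \notin L -> chi S (h |: L) = chi S L.
Proof. by move=> hS hL; rewrite /chi big_setU1 //= (negPf hS) mul1r. Qed.

(** Adding or removing from S an element of the symmetric difference of K and L
    is an involution which changes the sign of the summand. *)
Lemma chi_orth h K L : h \notin K -> h \notin L -> K != L ->
  \sum_(S : {set 'I_n} | h \notin S) chi S K * chi S L = 0.
Proof.
move=> hK hL KL; have [k kKL] : exists k, (k \in K) (+) (k \in L).
  apply/existsP; apply: contraNT KL => /existsPn e; apply/eqP/setP => k.
  by apply/eqP; have := e k; rewrite -negb_eqb negbK.
have hk : h != k by apply: contraTneq kKL => <-; rewrite (negPf hK) (negPf hL).
pose tog S := [set l | (l \in S) (+) (l == k)]%SET.
have togK : involutive tog by move=> S; apply/setP => l; rewrite !inE addbK.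
set s := (X in X = 0); have : s = - s.
  rewrite {1}/s (reindex_inj (can_inj togK)) /= /s -sumrN.
  apply: eq_big => [S|S _]; first by rewrite inE (negPf hk) addbF.
  rewrite !chi_toggle mulrACA -signr_addb kKL expr1 mulN1r //.
move=> ss; have : s *+ 2 == 0 by rewrite mulr2n {1}ss addNr.
by rewrite mulrn_eq0 => /eqP.
Qed.

Definition nflips h : R := #|[pred S : {set 'I_n} | h \notin S]|%:R.

Lemma nflips_neq0 h : nflips h != 0.
Proof.
rewrite pnatr_eq0 -lt0n; apply/card_gt0P; exists finset.set0.
by rewrite !inE.
Qed.

(** Fourier inversion for the group of subsets of the complement of h. *)
Lemma chi_inversion (V : lmodType R) h (b g : {set 'I_n} -> V) L :
  (forall S, h \notin S -> g S = \sum_(K : {set 'I_n} | h \notin K) chi S K *: b K) ->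
  h \notin L ->
  b L = (nflips h)^-1 *: \sum_(S : {set 'I_n} | h \notin S) chi S L *: g S.
Proof.
move=> gE hL; apply: (scalerI (nflips_neq0 h)).
rewrite scalerA mulfV ?nflips_neq0 // scale1r.
under eq_bigr => S hS do rewrite gE // scaler_sumr.
rewrite exchange_big /= (bigD1 L) //= [X in _ + X]big1 ?addr0 => [|K /andP[hK KL]].
  under eq_bigr => S _ do rewrite scalerA chi_sqr scale1r.
  by rewrite sumr_const scaler_nat.
under eq_bigr => S _ do rewrite scalerA.
by rewrite -scaler_suml chi_orth ?scale0r // eq_sym.
Qed.

Lemma sum_split_coord (V : nmodType) h (F : {set 'I_n} -> V) :
  \sum_(K : {set 'I_n}) F K =
  \sum_(L : {set 'I_n} | h \notin L) F L + \sum_(L : {set 'I_n} | h \notin L) F (h |: L).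
Proof.
rewrite (bigID (fun K : {set 'I_n} => h \notin K)) /=; congr (_ + _).
rewrite (reindex_onto (fun L => h |: L) (fun K : {set 'I_n} => K :\ h)) /=.
  apply: eq_bigl => L; rewrite negbK finset.setU11 /=.
  apply/eqP/idP => [<-|hL]; first by rewrite !inE eqxx.
  by rewrite finset.setU1K.
by move=> K; rewrite negbK => hK; rewrite finset.setD1K.
Qed.

Lemma subst_unit_flip S J h I : h \notin S ->
  subst_unit (flip S J) h I = flip S (subst_unit J h I).
Proof.
move=> hS; apply/funext => l; rewrite /subst_unit /flip; case: eqP => // ->.
by rewrite (negPf hS) expr0 scale1r.
Qed.

Lemma subst_unitN J h I : subst_unit J h (- I) = flip [set h]%SET (subst_unit J h I).
Proof.
apply/funext => l; rewrite /subst_unit /flip inE; case: eqP => _.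
  by rewrite expr1 scaleN1r.
by rewrite expr0 scale1r.
Qed.

Lemma chi_set1 h K : chi [set h]%SET K = (-1) ^+ (h \in K).
Proof.
have -> : [set h]%SET = [set l | (l \in (finset.set0 : {set 'I_n})) (+) (l == h)]%SET.
  by apply/setP => l; rewrite !inE.
rewrite chi_toggle /chi big1 ?mulr1 // => l _; by rewrite inE.
Qed.

Lemma qbracket_subst_notin J h I K (a : quat R) : h \notin K ->
  qbracket (subst_unit J h I) K a = qbracket J K a.
Proof.
move=> hK; rewrite /qbracket; congr (_ * _); apply: eq_bigr => l lK.
by rewrite /subst_unit; case: eqP => // lh; rewrite -lh lK in hK.
Qed.

(** Flipping the sign of I separates the subsets which contain h from those
    which do not; [chi_inversion] then isolates each L. *)
Lemma bracket_extraction J h (a g1 g2 : {set 'I_n} -> quat R) :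
  (forall S I, h \notin S -> imag_units I ->
    \sum_(K : {set 'I_n}) qbracket (subst_unit (flip S J) h I) K (a K) = g1 S + I * g2 S) ->
  forall L, h \notin L ->
  qbracket J L (a L) =
    (nflips h)^-1 *: \sum_(S : {set 'I_n} | h \notin S) chi S L *: g1 S /\
  forall I, imag_units I -> qbracket (subst_unit J h I) (h |: L) (a (h |: L)) =
    I * ((nflips h)^-1 *: \sum_(S : {set 'I_n} | h \notin S) chi S L *: g2 S).
Proof.
move=> ag.
suff parts S I : h \notin S -> imag_units I ->
    g1 S = \sum_(K : {set 'I_n} | h \notin K) chi S K *: qbracket J K (a K) /\
    I * g2 S = \sum_(K : {set 'I_n} | h \notin K)
       chi S K *: qbracket (subst_unit J h I) (h |: K) (a (h |: K)).
  move=> L hL; split=> [|I uI].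
    apply: (@chi_inversion _ h (fun L => qbracket J L (a L))) => // S hS.
    by have [] := parts S _ hS (quat_i_unit R).
  rewrite (@chi_inversion _ h (fun L => qbracket (subst_unit J h I) (h |: L) (a (h |: L)))
    (fun S => I * g2 S)) // => [|S hS]; last by have [] := parts S I hS uI.
  rewrite -scalerAr mulr_sumr; congr (_ *: _); apply: eq_bigr => S _.
  by rewrite scalerAr.
move=> hS uI; set T0 := (X in g1 S = X); set T1 := (X in _ * g2 S = X).
have e1 : T0 + T1 = g1 S + I * g2 S.
  rewrite -ag // (sum_split_coord h); congr (_ + _); apply: eq_bigr => L hL;
    rewrite subst_unit_flip // qbracket_flip ?chi_setU1 //.
  by rewrite qbracket_subst_notin.
have e2 : T0 - T1 = g1 S - I * g2 S.
  rewrite -mulNr -ag //; last exact: imag_unitsN.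
  rewrite (sum_split_coord h) -sumrN; congr (_ + _); apply: eq_bigr => L hL;
    rewrite subst_unit_flip // qbracket_flip subst_unitN qbracket_flip chi_set1.
    by rewrite (negPf hL) scale1r qbracket_subst_notin.
  by rewrite chi_setU1 // finset.setU11 expr1 scaleN1r scalerN.
have half (x y : quat R) : x + x = y + y -> x = y.
  rewrite -!mulr2n => e; apply: (@scalerI _ _ (2%:R : R)); first by rewrite pnatr_eq0.
  by rewrite !scaler_nat.
have sumE (x y : quat R) : x + y + (x - y) = x + x by rewrite addrACA subrr addr0.
have difE (x y : quat R) : x + y - (x - y) = y + y by rewrite opprB addrC addrA subrK.
split; apply: half.
- by rewrite -(sumE _ (I * g2 S)) -(sumE T0 T1) e1 e2.
- by rewrite -(difE (g1 S)) -(difE T0 T1) e1 e2.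
Qed.

Lemma prod_units_inv J (s : seq 'I_n) (P : pred 'I_n) : (forall l, imag_units (J l)) ->
  exists q : quat R, q * \prod_(k <- s | P k) J k = 1 /\ \prod_(k <- s | P k) J k * q = 1.
Proof.
move=> uJ; elim: s => [|k s [q [qp pq]]]; first by exists 1; rewrite big_nil mulr1.
rewrite big_cons; case: (P k); last by exists q.
exists (q * - J k); split.
  by rewrite -mulrA imag_units_mulNl.
by rewrite -mulrA (mulrA _ q) pq mul1r mulrN imag_units_sqr // opprK.
Qed.

Lemma prod_subst_notin J h I (s : seq 'I_n) (P : pred 'I_n) : h \notin s ->
  \prod_(k <- s | P k) subst_unit J h I k = \prod_(k <- s | P k) J k.
Proof.
move=> hs; rewrite !(big_seq_cond P); apply: eq_bigr => k /andP[ks _].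
by rewrite /subst_unit; case: eqP => // kh; rewrite -kh ks in hs.
Qed.

Lemma prod_subst_cat J h I (s1 s2 : seq 'I_n) (P : pred 'I_n) :
  h \notin s1 -> h \notin s2 -> P h ->
  \prod_(k <- s1 ++ h :: s2 | P k) subst_unit J h I k =
  \prod_(k <- s1 | P k) J k * I * \prod_(k <- s2 | P k) J k.
Proof.
move=> h1 h2 Ph; rewrite big_cat big_cons /= Ph !prod_subst_notin //.
by rewrite /subst_unit eqxx mulrA.
Qed.

(** The factors of the product J_K stand in the order of index_enum, so this
    splitting locates the factor J_h inside J_K. *)
Lemma index_enum_split h : exists s1 s2,
  [/\ index_enum 'I_n = s1 ++ h :: s2, h \notin s1 & h \notin s2].
Proof.
have := index_enum_uniq 'I_n; case/path.splitPr: (mem_index_enum h) => s1 s2.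
rewrite cat_uniq /= negb_or => /and3P[_ /andP[h1 _] /andP[h2 _]].
by exists s1, s2.
Qed.

Lemma prod_setU1_notin J h L (s : seq 'I_n) : h \notin s ->
  \prod_(k <- s | k \in h |: L) J k = \prod_(k <- s | k \in L) J k.
Proof.
move=> hs; rewrite !(big_seq_cond (fun k => k \in _)); apply: eq_bigl => k.
by rewrite !inE; case: eqP => // ->; rewrite (negPf hs).
Qed.

(** Writing J_(h |: L) = A I B, the hypothesis is A I (B a) = I c for all I, and
    [central_of_units] exchanges A and I. *)
Lemma bracket_commute J h L (a c : quat R) : (forall l, imag_units (J l)) ->
  h \notin L ->
  (forall I, imag_units I -> qbracket (subst_unit J h I) (h |: L) a = I * c) ->
  c = qbracket J L a.
Proof.
move=> uJ hL Ic; have [s1 [s2 [es h1 h2]]] := index_enum_split h.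
pose A := \prod_(k <- s1 | k \in L) J k; pose B := \prod_(k <- s2 | k \in L) J k.
have JL : qbracket J L a = A * (B * a).
  by rewrite /qbracket es big_cat big_cons /= (negPf hL) !mulrA.
have JhL I : qbracket (subst_unit J h I) (h |: L) a = A * I * (B * a).
  by rewrite /qbracket es prod_subst_cat ?finset.setU11 // !prod_setU1_notin // !mulrA.
have Ac I : imag_units I -> A * I * (B * a) = I * c by move=> uI; rewrite -JhL Ic.
apply: (imag_units_lreg (quat_i_unit R)).
rewrite -Ac; last exact: quat_i_unit.
by rewrite (central_of_units Ac (quat_i_unit R)) JL -!mulrA.
Qed.

(** Let k stand before h, so that J_K = X J_k Y J_h Z.  Pulling out J_h says that
    X J_k Y commutes with J_h for all J_k and J_h, which [no_central_conj] excludes. *)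
Lemma bracket_noncommute h k K (a : quat R) : h != k -> h \in K -> k \in K ->
  (forall J I, (forall l, imag_units (J l)) -> imag_units I ->
     qbracket (subst_unit J h I) K a = I * qbracket J (K :\ h) a) ->
  (forall J I, (forall l, imag_units (J l)) -> imag_units I ->
     qbracket (subst_unit J k I) K a = I * qbracket J (K :\ k) a) ->
  a = 0.
Proof.
move=> hk hK kK.
wlog: h k hk hK kK / (index k (index_enum 'I_n) < index h (index_enum 'I_n))%N.
  move=> W Eh Ek; 
  have [hlk|klh] := ltnP (index k (index_enum 'I_n)) (index h (index_enum 'I_n)).
    exact: (W h k).
  apply: (W k h) => //; first by rewrite eq_sym.
  rewrite ltn_neqAle klh andbT; apply: contra hk => /eqP e.
  by rewrite -(nth_index h (mem_index_enum h)) e nth_index ?mem_index_enum.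
move=> kh Eh _; apply/eqP/negPn/negP => a0.
have [s1 [s2 [es h1 h2]]] := index_enum_split h.
have ks1 : k \in s1.
  move: kh; rewrite es !index_cat (negPf h1) /= eqxx addn0.
  by case: ifP => // _; rewrite ltnNge leq_addr.
have us1 : uniq s1 by move: (index_enum_uniq 'I_n); rewrite es cat_uniq => /and3P[].
case/path.splitPr: ks1 es h1 us1 {kh} => t1 t2 es h1.
rewrite cat_uniq /= negb_or => /and3P[_ /andP[kt1 _] /andP[kt2 _]].
pose J0 (l : 'I_n) := quat_i R.
have uJ0 l : imag_units (J0 l) by exact: quat_i_unit.
pose pr s : quat R := \prod_(l <- s | l \in K) J0 l.
have [X' [XX _]] := prod_units_inv t1 (fun l => l \in K) uJ0.
have [Y' [_ YY]] := prod_units_inv t2 (fun l => l \in K) uJ0.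
have [Z' [ZZ _]] := prod_units_inv s2 (fun l => l \in K) uJ0.
have Za : pr s2 * a != 0.
  by apply: contra a0 => /eqP za; rewrite -[a]mul1r -ZZ -mulrA [_ * a]za mulr0.
apply: (no_central_conj XX YY) => J J' uJ uJ'; apply: (quat_rreg Za).
have ks2 : k \notin s2.
  move: (index_enum_uniq 'I_n); rewrite es -catA cat_uniq /= => /and3P[_ _].
  by rewrite mem_cat inE !negb_or => /andP[/and3P[]].
have := Eh (subst_unit J0 k J) J' (subst_unit_imag k uJ0 uJ) uJ'.
rewrite /qbracket es prod_subst_cat // prod_subst_cat //.
rewrite (prod_subst_notin _ _ _ ks2) => e.
rewrite !mulrA in e *; rewrite e -!mulrA; congr (J' * _).
rewrite big_cat big_cons /= !inE eqxx /=.
have congK (s : seq 'I_n) J1 : h \notin s ->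
    \prod_(l <- s | l \in K :\ h) J1 l = \prod_(l <- s | l \in K) J1 l.
  by move=> hs; rewrite -[in RHS](finset.setD1K hK) prod_setU1_notin.
rewrite !congK // prod_subst_cat // (prod_subst_notin _ _ _ ks2).
by rewrite !mulrA.
Qed.

End SignCharacters.

(** * Slice regularity in one variable as Cauchy-Riemann equations for the stem *)

Section SliceFunctions.
Variables (R : realType) (n : nat) (D : set 'rV[cplx R]_n).
Hypotheses (oD : open D) (cD : conj_invariant D).
Implicit Types (z : 'rV[cplx R]_n) (h k : 'I_n) (J : 'I_n -> quat R).
Implicit Types (S K L : {set 'I_n}) (I : quat R) (w : cplx R).
Implicit Types (F : 'rV[cplx R]_n -> qtensor R n) (f : 'rV[quat R]_n -> quat R).

Lemma induces_section F f h z J I w : induces D F f ->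
  (forall l, imag_units (J l)) -> imag_units I -> plane_section D h z w ->
  fun_section f h (slice_points J z) (slice_point I w) =
  \sum_(K : {set 'I_n}) qbracket (subst_unit J h I) K (F (subst_coord z h w) K).
Proof.
move=> Ff uJ uI Ew; rewrite /fun_section subst_slice_points Ff //.
exact: subst_unit_imag.
Qed.

(** The pair (G1 S, G2 S) is the one-variable stem of the section of f through
    the point whose units are those of J with signs flipped on S.  The predicate
    Q transports what is known of these stems: nothing for slice functions, the
    Cauchy-Riemann equations for slice regular ones. *)
Lemma section_reps (Q : set (cplx R) -> (cplx R -> quat R) -> (cplx R -> quat R) -> Prop)
    F f h z J :
  induces D F f ->
  (forall y, circ D y -> exists E, [/\ conj_invariant_one E,
     circ_section D h y = circ_one E & exists G1 G2,
       represents_one E G1 G2 (fun_section f h y) /\ Q E G1 G2]) ->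
  D z -> (forall l, imag_units (J l)) ->
  exists G1 G2 : {set 'I_n} -> cplx R -> quat R,
    (forall S, Q (plane_section D h z) (G1 S) (G2 S)) /\
    forall w L, plane_section D h z w -> h \notin L ->
      [/\ qbracket J L (F (subst_coord z h w) L) =
          (nflips R h)^-1 *: \sum_(S : {set 'I_n} | h \notin S) chi R S L *: G1 S w,
          qbracket J L (F (subst_coord z h w) (h |: L)) =
          (nflips R h)^-1 *: \sum_(S : {set 'I_n} | h \notin S) chi R S L *: G2 S w &
          forall I, imag_units I ->
          qbracket (subst_unit J h I) (h |: L) (F (subst_coord z h w) (h |: L)) =
          I * qbracket J L (F (subst_coord z h w) (h |: L))].
Proof.
move=> Ff sec Dz uJ.
have /choice[G GE] : forall S, exists G : (cplx R -> quat R) * (cplx R -> quat R),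
    Q (plane_section D h z) G.1 G.2 /\
    forall w I, plane_section D h z w -> imag_units I ->
      \sum_(K : {set 'I_n})
        qbracket (subst_unit (flip S J) h I) K (F (subst_coord z h w) K) =
      G.1 w + I * G.2 w.
  move=> S; have uS := flip_imag S uJ.
  have [|E [cE EE [G1 [G2 [[_ _ Grep] QG]]]]] := sec (slice_points (flip S J) z).
    by exists z, (flip S J).
  have EP : E = plane_section D h z.
    apply: circ_one_inj => //; first exact: plane_section_conj.
    by rewrite -EE circ_section_plane.
  rewrite {}EP in QG Grep; exists (G1, G2); split=> // w I Ew uI.
  by rewrite -Grep // -(induces_section Ff).
exists (fun S => (G S).1), (fun S => (G S).2).
split=> [S|w L Ew hL]; first by have [] := GE S.
have GE' S I : h \notin S -> imag_units I ->
    \sum_(K : {set 'I_n})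
      qbracket (subst_unit (flip S J) h I) K (F (subst_coord z h w) K) =
    (G S).1 w + I * (G S).2 w.
  by move=> _ uI; have [_] := GE S; apply.
have [e1 e2] := bracket_extraction GE' hL.
have e3 := bracket_commute uJ hL e2.
by split=> //; rewrite -e3.
Qed.

Lemma slice_wrt_bracket F f h z J I L : slice_wrt D h f -> induces D F f ->
  D z -> h \notin L -> (forall l, imag_units (J l)) -> imag_units I ->
  qbracket (subst_unit J h I) (h |: L) (F z (h |: L)) = I * qbracket J L (F z (h |: L)).
Proof.
move=> [_ sec] Ff Dz hL uJ uI.
have [|G1 [G2 [_ GE]]] := @section_reps (fun _ _ _ => True) F f h z J Ff _ Dz uJ.
  move=> y /sec[E [cE EE [G1 [G2 rep]]]]; exists E; split=> //.
  by exists G1, G2.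
have Ez : plane_section D h z (z 0 h) by rewrite /plane_section /= subst_coord_id.
by have [_ _] := GE _ _ Ez hL; rewrite subst_coord_id => br; exact: br.
Qed.

Lemma slice_wrt_vanish F f h k z K : h != k -> h \in K -> k \in K ->
  slice_wrt D h f -> slice_wrt D k f -> induces D F f -> D z -> F z K = 0.
Proof.
move=> hk hK kK hf kf Ff Dz; apply: (bracket_noncommute hk hK kK) => J I uJ uI.
- have hKh : h \notin K :\ h by rewrite !inE eqxx.
  by have := slice_wrt_bracket hf Ff Dz hKh uJ uI; rewrite finset.setD1K.
- have kKk : k \notin K :\ k by rewrite !inE eqxx.
  by have := slice_wrt_bracket kf Ff Dz kKk uJ uI; rewrite finset.setD1K.
Qed.

(** After left multiplication by an inverse of J_L, the two components are the
    same combination of the G1 S and of the G2 S. *)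
Lemma slice_regular_cauchy_riemann F f h z L : slice_regular_wrt D h f ->
  induces D F f -> D z -> h \notin L ->
  cauchy_riemann (plane_section D h z) (in_coord (fun u => F u L) h z)
                 (in_coord (fun u => F u (h |: L)) h z).
Proof.
move=> [_ sec] Ff Dz hL; pose J (l : 'I_n) := quat_i R.
have uJ l : imag_units (J l) by exact: quat_i_unit.
have [|G1 [G2 [CR GE]]] := @section_reps (@cauchy_riemann R) F f h z J Ff _ Dz uJ.
  move=> y /sec[E [cE EE [G1 [G2 [rep C1 C2 ab ba]]]]]; exists E; split=> //.
  by exists G1, G2; split.
have oE : open (plane_section D h z) by exact: plane_section_open.
have [q [qJ _]] := prod_units_inv (index_enum 'I_n) (fun l => l \in L) uJ.
pose c S := ((nflips R h)^-1 * chi R S L) *: q.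
have coef (a : quat R) (g : {set 'I_n} -> quat R) :
    qbracket J L a =
      (nflips R h)^-1 *: \sum_(S : {set 'I_n} | h \notin S) chi R S L *: g S ->
    a = \sum_(S : {set 'I_n} | h \notin S) c S * g S.
  move=> Ja; rewrite -[LHS]mul1r -qJ -mulrA [X in q * X]Ja -scalerAr mulr_sumr scaler_sumr.
  by apply: eq_bigr => S _; rewrite /c -scalerAr scalerA scalerAl.
apply: (@cauchy_riemann_congr _ _
  (fun w => \sum_(S : {set 'I_n} | h \notin S) c S * G1 S w)
  (fun w => \sum_(S : {set 'I_n} | h \notin S) c S * G2 S w)) => [|w Ew|w Ew|].
- exact: oE.
- by have [e _ _] := GE w L Ew hL; rewrite /in_coord (coef _ _ e).
- by have [_ e _] := GE w L Ew hL; rewrite /in_coord (coef _ _ e).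
by apply: (cauchy_riemann_sum _ oE) => S _; exact: (cauchy_riemann_qmul (c S) oE (CR S)).
Qed.

(** The one-variable stem is obtained from the pairs by left multiplication by
    J_L; [slice_wrt_bracket] allows pulling J_h to the left. *)
Lemma cauchy_riemann_slice_regular F f h : stem D F -> induces D F f ->
  slice_wrt D h f ->
  (forall z L, D z -> h \notin L ->
    cauchy_riemann (plane_section D h z) (in_coord (fun u => F u L) h z)
                 (in_coord (fun u => F u (h |: L)) h z)) ->
  slice_regular_wrt D h f.
Proof.
move=> sF Ff hf CR; split; first by case: hf.
move=> y [z [J [Dz uJ ->]]].
have oE : open (plane_section D h z) by exact: plane_section_open.
exists (plane_section D h z); split; first exact: plane_section_conj.
  by rewrite circ_section_plane.
exists (fun w => \sum_(L : {set 'I_n} | h \notin L)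
   qbracket J L (F (subst_coord z h w) L)).
exists (fun w => \sum_(L : {set 'I_n} | h \notin L)
   qbracket J L (F (subst_coord z h w) (h |: L))).
suff [C1 C2 ab ba] : cauchy_riemann (plane_section D h z)
  (fun w => \sum_(L : {set 'I_n} | h \notin L) qbracket J L (F (subst_coord z h w) L))
  (fun w => \sum_(L : {set 'I_n} | h \notin L)
   qbracket J L (F (subst_coord z h w) (h |: L))).
  split=> //; split.
  - move=> w Ew; apply: eq_bigr => L hL; rewrite -conj_coord_subst sF //.
    have -> : (L :&: [set h] = finset.set0)%SET.
      by apply/setP => l; rewrite !inE; case: eqP => [->|]; rewrite ?(negPf hL) ?andbF.
    by rewrite cards0 expr0 mul1r.
  - move=> w Ew; rewrite -sumrN; apply: eq_bigr => L hL; rewrite -conj_coord_subst sF //.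
    have -> : ((h |: L) :&: [set h] = [set h])%SET.
      by apply/setP => l; rewrite !inE; case: eqP => [->|]; rewrite ?andbF.
    by rewrite cards1 expr1 mulN1r /qbracket mulrN.
  - move=> w I Ew uI; rewrite (induces_section Ff) // (sum_split_coord h) mulr_sumr.
    congr (_ + _); apply: eq_bigr => L hL; first by rewrite qbracket_subst_notin.
    by rewrite (slice_wrt_bracket hf Ff).
apply: (cauchy_riemann_sum _ oE) => L hL.
exact: (cauchy_riemann_qmul _ oE (CR z L Dz hL)).
Qed.

Lemma calJE h (B : qtensor R n) K :
  calJ h B K = if h \in K then B (K :\ h) else - B (h |: K).
Proof.
rewrite /calJ sum_ffunE.
(* K' is the only subset whose image under calJ h has a component along K. *)
pose K' : {set 'I_n} := if h \in K then K :\ h else h |: K.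
rewrite (bigD1 K') //= big1 ?addr0 => [|L /eqP LK].
  rewrite /K'; have [hK|hK] := boolP (h \in K).
    by rewrite !inE eqxx /= ffunE finset.setD1K ?eqxx.
  by rewrite finset.setU11 !ffunE finset.setU1K ?eqxx.
have [hL|hL] := boolP (h \in L); rewrite !ffunE; case: eqP => // KL; rewrite ?oppr0 //;
  case: LK; rewrite /K' KL !inE eqxx /=.
  by rewrite finset.setD1K.
by rewrite finset.setU1K.
Qed.

Lemma dbar_eq0 h F z : dbar h F z = 0 <-> forall L, h \notin L ->
  pd_alpha h (fun u => F u L) z = pd_beta h (fun u => F u (h |: L)) z /\
  pd_beta h (fun u => F u L) z = - pd_alpha h (fun u => F u (h |: L)) z.
Proof.
split=> [dF L hL|CR].
  have {}dF K : pd_alpha h (fun u => F u K) z +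
      (if h \in K then pd_beta h (fun u => F u (K :\ h)) z
       else - pd_beta h (fun u => F u (h |: K)) z) = 0.
    have /ffunP/(_ K) := dF; rewrite /dbar !ffunE calJE !ffunE => /eqP.
    by rewrite scaler_eq0 invr_eq0 pnatr_eq0 /= => /eqP.
  have := dF L; rewrite (negPf hL) => /eqP; rewrite subr_eq0 => /eqP ->.
  have := dF (h |: L); rewrite finset.setU11 finset.setU1K // => /eqP.
  by rewrite addr_eq0 => /eqP ->; rewrite opprK.
apply/ffunP => K; rewrite /dbar !ffunE calJE !ffunE.
case: ifPn => hK; last by have [-> _] := CR K hK; rewrite subrr scaler0.
have [|_] := CR (K :\ h); first by rewrite !inE eqxx.
by rewrite finset.setD1K // => ->; rewrite subrr scaler0.
Qed.

(** Uniqueness of the stem function, for the zero slice function. *)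
Lemma induces0_eq0 h F z : induces D F (fun=> 0) -> D z -> F z = 0.
Proof.
move=> F0 Dz; pose J (l : 'I_n) := quat_i R.
have uJ l : imag_units (J l) by exact: quat_i_unit.
have inj (J' : 'I_n -> quat R) K (a : quat R) : (forall l, imag_units (J' l)) ->
    qbracket J' K a = 0 -> a = 0.
  move=> uJ' Ja.
  have [q [qJ _]] := prod_units_inv (index_enum 'I_n) (fun l => l \in K) uJ'.
  by rewrite -[LHS]mul1r -qJ -mulrA [X in q * X]Ja mulr0.
have F0' S I : h \notin S -> imag_units I ->
    \sum_(K : {set 'I_n}) qbracket (subst_unit (flip S J) h I) K (F z K) =
    0 + I * 0.
  move=> _ uI; rewrite -F0 //; first by rewrite mulr0 addr0.
  by apply: subst_unit_imag => //; exact: flip_imag.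
have e := bracket_extraction F0'.
have z0 L :
    (nflips R h)^-1 *: \sum_(S : {set 'I_n} | h \notin S) chi R S L *: (0 : quat R) = 0.
  by rewrite big1 ?scaler0 // => S _; rewrite scaler0.
apply/ffunP => K; rewrite [RHS]ffunE.
have [hK|hK] := boolP (h \in K); last first.
  by apply: (inj J K) => //; have [-> _] := e K hK.
have [|_ eK] := e (K :\ h); first by rewrite !inE eqxx.
have uI := quat_i_unit R; have := eK _ uI; rewrite z0 mulr0 finset.setD1K //.
by apply: inj; exact: subst_unit_imag.
Qed.

End SliceFunctions.

(** * Functions with vanishing partial derivatives *)

Section LocalConstancy.
Variable R : realType.
Implicit Types (phi : R -> quat R) (g : cplx R -> quat R) (w c : cplx R).

Lemma is_derive_translate phi (t : R) (d : quat R) :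
  is_derive (0 : R) 1 (fun s => phi (t + s)) d -> is_derive t 1 phi d.
Proof.
move=> [dphi dE].
have e : (fun h : R => h^-1 *: ((phi \o shift t) (h *: (1 : R)) - phi t)) =
   (fun h : R => h^-1 *: (((fun s => phi (t + s)) \o shift 0) (h *: (1 : R)) - phi (t + 0))).
  by apply/funext => h /=; rewrite !addr0 (addrC t).
by split; [rewrite /derivable e|rewrite /derive e].
Qed.

(** The mean value theorem is applied to each real coordinate. *)
Lemma is_derive0_segment phi (x y : R) : x <= y ->
  (forall t, x <= t <= y -> is_derive t 1 phi 0) -> phi x = phi y.
Proof.
move=> xy dphi; apply: quatP => k _; apply/esym/eqP; rewrite -subr_eq0.
have dk t : x <= t <= y -> is_derive t 1 (fun s => qcoord (phi s) k) 0.
  by move=> /dphi/(is_derive_qcoord k); rewrite qcoord0.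
have [t|t|c _ ->] := @MVT_segment R (fun s => qcoord (phi s) k) (fun=> 0) x y xy.
- by rewrite in_itv /= => /andP[/ltW xt /ltW ty]; apply: dk; rewrite xt.
- apply: derivable_within_continuous => s; rewrite in_itv /= => /dk[ds _].
  exact: ds.
- by rewrite mul0r.
Qed.

Lemma is_derive0_cst phi (x y : R) :
  (forall t, Order.min x y <= t <= Order.max x y -> is_derive t 1 phi 0) -> phi x = phi y.
Proof.
have [xy|/ltW yx] := leP x y => dphi; first exact: is_derive0_segment xy dphi.
by apply/esym/is_derive0_segment.
Qed.

Lemma cst_on_ball g c (e : R[i]) : 0 < e ->
  (forall w, ball c e w -> is_derive (0 : R) 1 (along_re g w) 0) ->
  (forall w, ball c e w -> is_derive (0 : R) 1 (along_im g w) 0) ->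
  forall w, ball c e w -> g w = g c.
Proof.
case: e => r i; rewrite ltcE => /= /andP[/eqP -> r0] dre dim [a b].
case: c dre dim => c d dre dim.
have ballE (x y : R) :
    ball ((c +i* d)%C : cplx R) ((r +i* 0)%C : R[i]) ((x +i* y)%C : cplx R) =
    (Num.sqrt ((c - x) ^+ 2 + (d - y) ^+ 2) < r).
  by rewrite /ball /= normc_def /= ltcE /= eqxx.
rewrite ballE => abr.
have in_ball (x y : R) : (c - x) ^+ 2 <= (c - a) ^+ 2 -> (d - y) ^+ 2 <= (d - b) ^+ 2 ->
    ball ((c +i* d)%C : cplx R) ((r +i* 0)%C : R[i]) ((x +i* y)%C : cplx R).
  move=> xa yb; rewrite ballE; apply: le_lt_trans abr; apply: ler_wsqrtr.
  exact: lerD.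
have between (u v t : R) :
    Order.min v u <= t <= Order.max v u -> (u - t) ^+ 2 <= (u - v) ^+ 2.
  move=> vtu; rewrite -subr_ge0.
  have -> : (u - v) ^+ 2 - (u - t) ^+ 2 = (t - v) * (u - t + (u - v)) by ring.
  case: (leP v u) vtu => uv /andP[vt tu]; first by apply: mulr_ge0; lra.
  by apply: mulr_le0; lra.
(* Only the partial derivatives are known to vanish, so the path from w to the
   centre runs parallel to the axes; it stays in the disc. *)
transitivity (g (c +i* b)%C).
- apply: (@is_derive0_cst (fun t => g (t +i* b)%C) a c) => t tac.
  apply: is_derive_translate.
  have := dre (t +i* b)%C (in_ball _ _ (between _ _ _ tac) (lexx _)).
  rewrite (_ : along_re g _ = fun s : R => g ((t + s) +i* b)%C) //.
  by apply/funext => s; rewrite /along_re; congr g; apply/eqP;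
     rewrite eq_complex /= addr0 !eqxx.
- apply: (@is_derive0_cst (fun t => g (c +i* t)%C) b d) => t tbd.
  apply: is_derive_translate.
  have := dim (c +i* t)%C (in_ball _ _ _ (between _ _ _ tbd)).
  rewrite subrr expr0n sqr_ge0 => /(_ isT).
  rewrite (_ : along_im g _ = fun s : R => g (c +i* (t + s))%C) //.
  by apply/funext => s; rewrite /along_im; congr g; apply/eqP;
     rewrite eq_complex /= addr0 !eqxx.
Qed.

Variable n : nat.
Implicit Types (z u : 'rV[cplx R]_n) (h k : 'I_n) (D : set 'rV[cplx R]_n).

(** The coordinates other than h are moved to those of z one at a time. *)
Lemma cst_on_polydisc (G : 'rV[cplx R]_n -> quat R) h z (e : R[i]) : 0 < e ->
  (forall u k, ball z e u -> k != h ->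
     is_derive (0 : R) 1 (along_re (in_coord G k u) (u 0 k)) 0 /\
     is_derive (0 : R) 1 (along_im (in_coord G k u) (u 0 k)) 0) ->
  forall u, ball z e u -> G u = G (subst_coord z h (u 0 h)).
Proof.
move=> e0 dG u [_ zu].
pose mix (s : seq 'I_n) := \row_l (if l \in s then z 0 l else u 0 l).
have mixb s : ball z e (mix s).
  by split=> // i j; rewrite mxE (ord1 i); case: ifP => _; [exact: ballxx|exact: zu].
suff Gm s : h \notin s -> G u = G (mix s).
  (* Moving all coordinates but h reaches subst_coord z h (u 0 h). *)
  rewrite (Gm (rem h (enum 'I_n))); last by rewrite mem_rem_uniq ?enum_uniq // inE eqxx.
  congr G; apply/rowP => l; rewrite !mxE mem_rem_uniq ?enum_uniq // inE mem_enum andbT.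
  by case: eqP => // ->.
elim: s => [_|k s IHs].
  by congr G; apply/rowP => l; rewrite mxE.
rewrite inE negb_or => /andP[hk hs]; rewrite (IHs hs).
have -> : mix (k :: s) = subst_coord (mix s) k (z 0 k).
  by apply/rowP => l; rewrite !mxE inE; case: eqP => // ->.
rewrite -{1}(subst_coord_id (mix s) k).
have sub_ball w : ball (z 0 k) e w -> ball z e (subst_coord (mix s) k w).
  move=> zw; split=> // i j; rewrite (ord1 i) !mxE; case: eqP => [-> //|_].
  by case: ifP => _; [exact: ballxx|exact: zu].
have sec w : in_coord G k (subst_coord (mix s) k w) = in_coord G k (mix s).
  by apply/funext => w'; rewrite /in_coord subst_coordK.
apply: (@cst_on_ball (in_coord G k (mix s)) (z 0 k) e e0) => [w|w|].
- move=> /sub_ball zw; have [] := dG _ k zw; first by rewrite eq_sym.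
  by rewrite sec subst_coord_same.
- move=> /sub_ball zw; have [] := dG _ k zw; first by rewrite eq_sym.
  by rewrite sec subst_coord_same.
- by have [_ zm] := mixb s; exact: zm.
Qed.

End LocalConstancy.

(** * Continuity of the derivatives of stem functions *)

Section RegularityOfStems.
Variables (R : realType) (n : nat) (D : set 'rV[cplx R]_n).
Hypotheses (oD : open D) (cD : conj_invariant D).
Implicit Types (z u : 'rV[cplx R]_n) (h k : 'I_n) (G : 'rV[cplx R]_n -> quat R).
Implicit Types (K L : {set 'I_n}).
Implicit Types (F : 'rV[cplx R]_n -> qtensor R n) (f : 'rV[quat R]_n -> quat R).

Lemma in_coord_subst G h z w : in_coord G h (subst_coord z h w) = in_coord G h z.
Proof. by apply/funext => w'; rewrite /in_coord subst_coordK. Qed.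

Lemma plane_section_base h z : D z -> plane_section D h z (z 0 h).
Proof. by rewrite /plane_section /= subst_coord_id. Qed.

Lemma C1_plane_section G h z : C1 D G -> C1_one (plane_section D h z) (in_coord G h z).
Proof.
move=> CG w Ew; have [da db ca cb] := CG _ h Ew.
rewrite in_coord_subst subst_coord_same in da db.
split; [exact: da|exact: db| |].
- have -> : d_alpha (in_coord G h z) = pd_alpha h G \o subst_coord z h.
    by apply/funext => v; rewrite /= /pd_alpha in_coord_subst subst_coord_same.
  by apply: continuous_comp; [exact: subst_coord_continuous|exact: ca].
- have -> : d_beta (in_coord G h z) = pd_beta h G \o subst_coord z h.
    by apply/funext => v; rewrite /= /pd_beta in_coord_subst subst_coord_same.
  by apply: continuous_comp; [exact: subst_coord_continuous|exact: cb].
Qed.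

Lemma slice_regular_wrt_ker f h : slice_C1 D f -> slice_regular_wrt D h f ->
  ker_dbar D h f.
Proof.
move=> [F [sF CF] Ff] hf; exists F; split=> //.
suff dF0 z : D z -> dbar h F z = 0.
  move=> z J Dz _; rewrite dF0 // big1 // => K _.
  by rewrite /qbracket ffunE mulr0.
move=> Dz; apply/dbar_eq0 => L hL.
have [_ _ ab ba] := slice_regular_cauchy_riemann oD cD hf Ff Dz hL.
have Ez := plane_section_base h Dz.
by rewrite /pd_alpha /pd_beta (ab _ Ez) (ba _ Ez).
Qed.

Lemma ker_slice_regular_wrt f h : slice_wrt D h f -> ker_dbar D h f ->
  slice_regular_wrt D h f.
Proof.
move=> hf [F [[sF CF] Ff dF]]; apply: (cauchy_riemann_slice_regular oD cD sF Ff hf).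
move=> z L Dz hL.
have CR w : plane_section D h z w ->
    d_alpha (in_coord (fun u => F u L) h z) w =
      d_beta (in_coord (fun u => F u (h |: L)) h z) w /\
    d_beta (in_coord (fun u => F u L) h z) w =
      - d_alpha (in_coord (fun u => F u (h |: L)) h z) w.
  move=> Ew; have /dbar_eq0/(_ L hL) := induces0_eq0 h dF Ew.
  by rewrite /pd_alpha /pd_beta !in_coord_subst subst_coord_same.
split; [exact: C1_plane_section|exact: C1_plane_section| |].
- by move=> w /CR[].
- by move=> w /CR[].
Qed.

Lemma slice_regular_slice_wrt f h : slice_regular_wrt D h f -> slice_wrt D h f.
Proof.
move=> [sf reg]; split=> // y /reg[E [cE UE [G1 [G2 [rep _ _ _ _]]]]].
by exists E; split=> //; exists G1, G2.
Qed.

(** Locally G is a function of the coordinate h alone, so its derivatives are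
    those of the section through z composed with the projection to that
    coordinate. *)
Lemma pd_continuous_local G h z (e : R[i]) : 0 < e ->
  (forall u, ball z e u -> G u = G (subst_coord z h (u 0 h))) ->
  C1_one (ball (z 0 h) e) (in_coord G h z) ->
  {for z, continuous (pd_alpha h G)} /\ {for z, continuous (pd_beta h G)}.
Proof.
move=> e0 Gh C1z; have oE : open (ball (z 0 h) e) by exact: ball_open.
have Ez : ball (z 0 h) e (z 0 h) by exact: ballxx.
have near_z : \forall u \near z, ball z e u by exact: nbhsx_ballx.
have same u : ball z e u ->
    d_alpha (in_coord G h u) (u 0 h) = d_alpha (in_coord G h z) (u 0 h) /\
    d_beta (in_coord G h u) (u 0 h) = d_beta (in_coord G h z) (u 0 h).
  move=> [_ zu]; have [w Ew|_ da db] := C1_one_congr (g' := in_coord G h u) oE _ C1z.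
  - rewrite /in_coord [RHS]Gh ?subst_coord_same //.
    by split=> // i j; rewrite (ord1 i) mxE; case: eqP => [-> //|_]; exact: zu.
  - by split; [exact: da|exact: db].
have [_ _ ca cb] := C1z _ Ez.
have ch : {for z, continuous (fun u => u 0 h)} by exact: coord_continuous.
split.
- apply: near_eq_continuous (continuous_comp ch ca).
  by apply: filterS near_z => u /same[/esym].
- apply: near_eq_continuous (continuous_comp ch cb).
  by apply: filterS near_z => u /same[_ /esym].
Qed.

Lemma pd_eq0 G h z : (forall u, D u -> G u = 0) -> D z ->
  pd_alpha h G z = 0 /\ pd_beta h G z = 0.
Proof.
move=> G0 Dz; have oE : open (plane_section D h z) by exact: plane_section_open.
have [C0 a0 b0] := C1_one0 oE.
have [w Ew|_ da db] := C1_one_congr (g' := in_coord G h z) oE _ C0.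
  by rewrite /in_coord G0.
have Ez := plane_section_base h Dz.
by rewrite /pd_alpha /pd_beta (da _ Ez) (db _ Ez) a0 b0.
Qed.

(** Only subsets with at most one element carry a nonzero component, and every
    partial derivative in z_h is either zero near the point or, up to sign, a
    derivative of the component of [set h]. *)
Lemma slice_regular_all_C1 f F : (forall h, slice_regular_wrt D h f) ->
  stem D F -> induces D F f -> C1_stem D F.
Proof.
move=> reg sF Ff; split; [exact: sF|move=> K].
have CR z h L (Dz : D z) (hL : h \notin L) :=
  slice_regular_cauchy_riemann oD cD (reg h) Ff Dz hL.
have F0 z h k L : D z -> h != k -> h \in L -> k \in L -> F z L = 0.
  by move=> Dz hk hL kL; apply: (slice_wrt_vanish cD hk hL kL _ _ Ff Dz);
    exact: slice_regular_slice_wrt.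
have C1K z h L : D z -> C1_one (plane_section D h z) (in_coord (fun u => F u L) h z).
  move=> Dz; have [hL|hL] := boolP (h \in L); last by have [] := CR z h L Dz hL.
  have hLh : h \notin L :\ h by rewrite !inE eqxx.
  by have [_] := CR z h _ Dz hLh; rewrite finset.setD1K.
have pd_cont1 z h : D z ->
    {for z, continuous (pd_alpha h (fun u => F u [set h]%SET))} /\
    {for z, continuous (pd_beta h (fun u => F u [set h]%SET))}.
  move=> Dz; have /nbhs_ballP[e /= e0 eD] := open_nbhs_nbhs (conj oD Dz).
  apply: (pd_continuous_local e0); last first.
    move=> w zw; apply: (C1K z h _ Dz); apply: eD.
    by split=> // i j; rewrite (ord1 i) mxE; case: eqP => [-> //|_]; exact: ballxx.
  (* For k != h the Cauchy-Riemann partner of F_[set h] in the direction k is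
   F_(k |: [set h]), which vanishes. *)
  apply: (cst_on_polydisc e0) => u k /eD Du kh.
  have kL : k \notin [set h]%SET by rewrite inE.
  have Eu := plane_section_base k Du.
  have [Ch _ ab ba] := CR u k _ Du kL.
  have [a0 b0] : pd_alpha k (fun u => F u (k |: [set h]%SET)) u = 0 /\
      pd_beta k (fun u => F u (k |: [set h]%SET)) u = 0.
    by apply: pd_eq0 => // v Dv; apply: (F0 v k h _ Dv kh); rewrite !inE eqxx ?orbT.
  split.
  - have := C1_one_is_derive_re Ch Eu.
    by rewrite (ab _ Eu) [d_beta _ _]b0.
  - have := C1_one_is_derive_im Ch Eu.
    by rewrite (ba _ Eu) [d_alpha _ _]a0 oppr0.
have pd_cont z h L : D z -> h \in L ->
    {for z, continuous (pd_alpha h (fun u => F u L))} /\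
    {for z, continuous (pd_beta h (fun u => F u L))}.
  move=> Dz hL; have [->|Lh] := eqVneq L [set h]%SET; first exact: pd_cont1.
  have [k kL kh] : exists2 k, k \in L & k != h.
    apply/exists_inP; apply: contraNT Lh => /exists_inPn Lh; apply/eqP/setP => k.
    rewrite inE; apply/idP/eqP => [/Lh|-> //].
    by rewrite negbK => /eqP.
  have z0 u : D u -> F u L = 0 by move=> Du; apply: (F0 u k h _ Du kh).
  split; apply: (near_eq_continuous (a := fun=> 0)); try exact: cst_continuous.
  - apply: filterS (open_nbhs_nbhs (conj oD Dz)) => u Du.
    by have [-> _] := pd_eq0 h z0 Du.
  - apply: filterS (open_nbhs_nbhs (conj oD Dz)) => u Du.
    by have [_ ->] := pd_eq0 h z0 Du.
move=> z h Dz; have [da db _ _] := C1K z h K Dz _ (plane_section_base h Dz).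
have [hK|hK] := boolP (h \in K).
  by have [ca cb] := pd_cont z h K Dz hK;
    split; [exact: da|exact: db|exact: ca|exact: cb].
(* Here the Cauchy-Riemann equations express the derivatives of F_K by those
   of F_(h |: K). *)
have [ca cb] := pd_cont z h (h |: K) Dz (finset.setU11 _ _).
have nD := open_nbhs_nbhs (conj oD Dz).
split; [exact: da|exact: db| |].
- apply: near_eq_continuous cb; apply: filterS nD => u Du.
  by have [_ _ ab _] := CR u h K Du hK; apply/esym/ab/plane_section_base.
- apply: near_eq_continuous (continuousN ca); apply: filterS nD => u Du.
  by have [_ _ _ ba] := CR u h K Du hK; apply/esym/ba/plane_section_base.
Qed.

End RegularityOfStems.

(** * The kernel characterization of slice regularity *)

Theorem proposition3p2 (R : realType) (n : nat) (D : set 'rV[cplx R]_n)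
    (n_gt0 : (0 < n)%N) (D_open : open D) (D_conj : conj_invariant D)
    (H : {set 'I_n}) :
  slice_C1 D `&` slice_regular_in D H =
    slice_C1 D `&` (slice_in D H `&` \bigcap_(h in [set` H]) ker_dbar D h)
  /\
  (H = finset.set0 \/ H = [set: 'I_n]%SET ->
   slice_regular_in D H =
     slice_in D H `&` \bigcap_(h in [set` H]) ker_dbar D h).
Proof.
have sub f : slice_C1 D f -> slice_regular_in D H f ->
    (slice_in D H `&` \bigcap_(h in [set` H]) ker_dbar D h) f.
  move=> Cf [sf reg]; split; first split=> // h hH.
    exact/slice_regular_slice_wrt/reg.
  by move=> h hH; exact: (slice_regular_wrt_ker D_open D_conj Cf (reg h hH)).
have sup f : (slice_in D H `&` \bigcap_(h in [set` H]) ker_dbar D h) f ->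
    slice_regular_in D H f.
  move=> [[sf wrt] ker]; split=> // h hH.
  exact: (ker_slice_regular_wrt D_open D_conj (wrt h hH) (ker h hH)).
split=> [|Hall]; apply/seteqP; split=> f.
- by move=> [Cf reg]; split=> //; exact: sub.
- by move=> [Cf ker]; split=> //; exact: sup.
- case: Hall => HE reg.
    have H0 h : ~ [set` H] h by rewrite HE /= inE.
    by have [sf _] := reg; split; [split=> // h /H0|move=> h /H0].
  apply: (sub _ _ reg); have [[F sF Ff] regf] := reg; exists F => //.
  apply: (slice_regular_all_C1 D_open D_conj _ sF Ff) => h.
  by apply: regf; rewrite HE /= inE.
- exact: sup.
Qed.
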